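(* The Green ring $r(H_{n,d})$ is isomorphic to the quotient ring $\mathbb{Z}[y,z]/I$ of the polynomial ring $\mathbb{Z}[y,z]$ modulo the ideal $I$ generated by the two elements $$y^n-1,\qquad (z-y^m-1)F_d(y^m,z).$$ Moreover, under this isomorphism (the one in which $y$ corresponds to $[M(1,-1)]$ and $z$ corresponds to $[M(2,0)]$), the class of the polynomial $F_s(y^m,z)$ corresponds to $[M(s,0)]$ for all $2\leq s\leq d$.
   Context: Let $K$ be an algebraically closed field of characteristic $0$, let $n,d\geq 2$ be integers with $d\mid n$, put $m=n/d$, and let $q\in K$ be a primitive $d$-th root of unity. The generalized Taft algebra $H_{n,d}=H_{n,d}(q)$ is the $K$-algebra generated by $g,h$ subject to $g^n=1$, $h^d=0$, $hg=qgh$; it is a Hopf algebra of dimension $nd$ with $\Delta(g)=g\otimes g$, $\Delta(h)=1\otimes h+h\otimes g$, $\varepsilon(g)=1$, $\varepsilon(h)=0$, $S(g)=g^{-1}$, $S(h)=-q^{-1}g^{n-1}h$. Modules are finite dimensional left modules; tensor products of modules are over $K$ with action through $\Delta$. Fix a primitive $n$-th root of unity $\omega\in K$ with $\omega^m=q$. For $1\leq l\leq d$ and $i\in\mathbb{Z}_n=\mathbb{Z}/(n)$, $M(l,i)$ is the $H_{n,d}$-module with basis $v_0,\dots,v_{l-1}$ and action $g\cdot v_j=\omega^i q^{-j}v_j$, $h\cdot v_j=v_{j+1}$ for $0\le j\leq l-2$, $h\cdot v_{l-1}=0$. The modules $M(l,i)$ form a complete list of pairwise non-isomorphic indecomposable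 $H_{n,d}$-modules. The Green ring $r(H)$ of a Hopf algebra $H$ is the abelian group generated by isomorphism classes $[V]$ of finite dimensional $H$-modules modulo $[V\oplus W]=[V]+[W]$, with multiplication $[V][W]=[V\otimes W]$. The generalized Fibonacci polynomials $F_s(y,z)\in\mathbb{Z}[y,z]$ are defined by $F_0(y,z)=0$, $F_1(y,z)=1$, $F_2(y,z)=z$ and $F_{s+2}(y,z)=zF_{s+1}(y,z)-yF_s(y,z)$ for $s\geq 1$. *)

(* Defs.v *)
From HB Require Import structures.
From mathcomp Require Import all_boot all_order all_algebra.
From mathcomp Require Import boolp.
From mathcomp Require Import mxtens freeg.

Set Implicit Arguments.
Unset Strict Implicit.
Unset Printing Implicit Defensive.

Import GRing.Theory.
Local Open Scope ring_scope.
Local Open Scope quotient_scope.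

(** An element of [A (x) B] is written as a finite sum of pure tensors, that is
    as a list of pairs.  Two such sums are the same tensor if and only if every
    bilinear map out of [A * B] takes the same value on them (universal property
    of [A (x) B]); similarly for threefold tensors. *)

Section Tensors.
Variable K : fieldType.

Definition bilinear_map (A B U : lmodType K) (b : A -> B -> U) : Prop :=
  (forall y, linear (b^~ y)) /\ (forall x, linear (b x)).

Definition trilinear_map (A B C U : lmodType K) (t : A -> B -> C -> U) : Prop :=
  [/\ forall y z, linear (fun x => t x y z),
      forall x z, linear (fun y => t x y z)
    & forall x y, linear (t x y)].

Definition tens2_eq (A B : lmodType K) (s t : seq (A * B)) : Prop :=
  forall (U : lmodType K) (b : A -> B -> U), bilinear_map b ->
    \sum_(p <- s) b p.1 p.2 = \sum_(p <- t) b p.1 p.2.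

Definition tens3_eq (A B C : lmodType K) (s t : seq (A * B * C)) : Prop :=
  forall (U : lmodType K) (b : A -> B -> C -> U), trilinear_map b ->
    \sum_(p <- s) b p.1.1 p.1.2 p.2 = \sum_(p <- t) b p.1.1 p.1.2 p.2.

(** [comul x] is a choice of a finite sum of pure tensors representing the
    coproduct of [x]. *)
Record hopfAlg := HopfAlg {
  halg :> algType K;
  comul : halg -> seq (halg * halg);
  counit : {lrmorphism halg -> K | *%R};
  antipode : {linear halg -> halg};
  comul_linear : forall a x y,
    tens2_eq (comul (a *: x + y))
             ([seq (a *: p.1, p.2) | p <- comul x] ++ comul y);
  comul1 : tens2_eq (comul 1) [:: (1, 1)];
  comulM : forall x y,
    tens2_eq (comul (x * y))
             [seq (p.1 * r.1, p.2 * r.2) | p <- comul x, r <- comul y];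
  comulA : forall x,
    tens3_eq [seq (r.1, r.2, p.2) | p <- comul x, r <- comul p.1]
             [seq (p.1, r.1, r.2) | p <- comul x, r <- comul p.2];
  counit_l : forall x, \sum_(p <- comul x) counit p.1 *: p.2 = x;
  counit_r : forall x, \sum_(p <- comul x) counit p.2 *: p.1 = x;
  antipode_l : forall x, \sum_(p <- comul x) antipode p.1 * p.2 = (counit x)%:A;
  antipode_r : forall x, \sum_(p <- comul x) p.1 * antipode p.2 = (counit x)%:A
}.

End Tensors.

Arguments counit {K h}.
Arguments antipode {K h}.


(** Up to isomorphism a finite dimensional left module is [K^k], seen as column
    vectors, with [x] acting by [v |-> mact x *m v]. *)

Section Modules.
Variables (K : fieldType) (H : hopfAlg K).

Record hmod := HMod {
  mdim : nat;
  mact :> {lrmorphism H -> 'M[K]_mdim}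
}.

HB.instance Definition _ := gen_eqMixin hmod.
HB.instance Definition _ := gen_choiceMixin hmod.

Definition hmod_iso (V W : hmod) : Prop :=
  exists (P : 'M[K]_(mdim W, mdim V)) (Q : 'M[K]_(mdim V, mdim W)),
    [/\ P *m Q = 1%:M, Q *m P = 1%:M & forall x, P *m V x = W x *m P].

Section DirectSum.
Variables V W : hmod.
Definition dsum_act (x : H) : 'M[K]_(mdim V + mdim W) :=
  block_mx (V x) 0 0 (W x).

Fact dsum_act_linear : linear dsum_act.
Proof.
move=> a x y; rewrite /dsum_act !linearP /=.
by rewrite scale_block_mx add_block_mx !scaler0 !addr0.
Qed.

Fact dsum_act_monoid : monoid_morphism dsum_act.
Proof.
split; first by rewrite /dsum_act !rmorph1 -scalar_mx_block.
move=> x y; rewrite /dsum_act !rmorphM /= -[RHS]/(_ *m _) mulmx_block.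
by rewrite !mulmx0 !mul0mx !addr0 add0r.
Qed.

HB.instance Definition _ :=
  GRing.isLinear.Build K H 'M[K]_(mdim V + mdim W) _ dsum_act dsum_act_linear.
HB.instance Definition _ :=
  GRing.isMonoidMorphism.Build H 'M[K]_(mdim V + mdim W) dsum_act dsum_act_monoid.

Definition hmod_sum : hmod := HMod dsum_act.
End DirectSum.

Section TensorProduct.
Variables V W : hmod.
Definition tens_act (x : H) : 'M[K]_(mdim V * mdim W) :=
  \sum_(p <- comul x) V p.1 *t W p.2.

Fact tensmx_bilinear (k l m n : nat) :
  bilinear_map (fun (A : 'M[K]_(k, l)) (B : 'M[K]_(m, n)) => A *t B).
Proof.
split=> [B a A A'|A a B B']; apply/matrixP=> i j; rewrite !mxE.
  by rewrite mulrDl mulrA.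
by rewrite mulrDr mulrCA.
Qed.

Fact act_bilinear : bilinear_map (fun x y : H => V x *t W y).
Proof.
have [tl tr] := tensmx_bilinear (mdim V) (mdim V) (mdim W) (mdim W).
by split=> [y a x x'|x a y y'] /=; rewrite linearP (tl, tr).
Qed.

Fact tens_act_linear : linear tens_act.
Proof.
move=> a x y; apply: etrans (@comul_linear _ H a x y _ _ act_bilinear) _.
rewrite big_cat big_map /=.
rewrite scaler_sumr; congr (_ + _); apply: eq_bigr=> p _.
rewrite linearZ /=; apply/matrixP=> i j; rewrite !mxE; exact: esym (mulrA _ _ _).
Qed.

Fact tens_act_monoid : monoid_morphism tens_act.
Proof.
split.
  apply: etrans (@comul1 _ H _ _ act_bilinear) _; rewrite big_seq1 /= !rmorph1.
  apply/matrixP=> i j; case: (mxtens_indexP i) => i1 i2; case: (mxtens_indexP j) => j1 j2.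
  rewrite tensmxE !mxE -natrM mulnb.
  by rewrite (can_eq (@mxtens_indexK _ _)) xpair_eqE.
move=> x y; apply: etrans (@comulM _ H x y _ _ act_bilinear) _; rewrite big_allpairs_dep /=.
rewrite [RHS]mulmx_suml; apply: eq_bigr=> p _; rewrite mulmx_sumr.
apply: eq_bigr=> r _; rewrite !rmorphM /=.
exact: esym (tensmx_mul _ _ _ _).
Qed.

HB.instance Definition _ :=
  GRing.isLinear.Build K H 'M[K]_(mdim V * mdim W) _ tens_act tens_act_linear.
HB.instance Definition _ :=
  GRing.isMonoidMorphism.Build H 'M[K]_(mdim V * mdim W) tens_act tens_act_monoid.

Definition hmod_tens : hmod := HMod tens_act.
End TensorProduct.

Definition unit_act (x : H) : 'M[K]_1 := (counit x)%:M.

Fact unit_act_linear : linear unit_act.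
Proof. by move=> a x y; rewrite scale_scalar_mx -raddfD /unit_act linearP. Qed.

Fact unit_act_monoid : monoid_morphism unit_act.
Proof.
by split=> [|x y]; rewrite /unit_act ?rmorph1 // rmorphM scalar_mxM.
Qed.

HB.instance Definition _ :=
  GRing.isLinear.Build K H 'M[K]_1 _ unit_act unit_act_linear.
HB.instance Definition _ :=
  GRing.isMonoidMorphism.Build H 'M[K]_1 unit_act unit_act_monoid.

Definition hmod1 : hmod := HMod unit_act.

Lemma hmod_iso_reindex (V W : hmod)
    (s : 'I_(mdim V) -> 'I_(mdim W)) (t : 'I_(mdim W) -> 'I_(mdim V)) :
    cancel s t -> cancel t s ->
    (forall x i j, V x i j = W x (s i) (s j)) ->
  hmod_iso V W.
Proof.
move=> sK tK VW.
have sumd n (a : 'I_n) (F : 'I_n -> K) : \sum_k (k == a)%:R * F k = F a.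
  rewrite (bigD1 a) //= eqxx mul1r big1 ?addr0 // => k /negPf->.
  by rewrite mul0r.
have st i k : (k == t i) = (i == s k) by rewrite eq_sym (can2_eq tK sK).
exists (\matrix_(i, k) (k == t i)%:R), (\matrix_(k, i) (k == t i)%:R).
split=> [||x]; apply/matrixP=> i j; rewrite !mxE.
- under eq_bigr do rewrite !mxE.
  by rewrite sumd (can_eq tK).
- under eq_bigr do rewrite !mxE !st.
  by rewrite sumd (can_eq sK).
under eq_bigr do rewrite !mxE.
rewrite sumd; under eq_bigr do rewrite !mxE st mulrC.
by rewrite sumd VW tK.
Qed.

Lemma hmod_iso_refl V : hmod_iso V V.
Proof. exact: (@hmod_iso_reindex V V id id). Qed.

Lemma hmod_iso_dim V W : hmod_iso V W -> mdim V = mdim W.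
Proof.
case=> P [Q [PQ QP _]]; apply/eqP; rewrite eqn_leq.
by rewrite (mulmx1_min QP) (mulmx1_min PQ).
Qed.

Lemma hmod_iso_tens V V' W W' : hmod_iso V V' -> hmod_iso W W' ->
  hmod_iso (hmod_tens V W) (hmod_tens V' W').
Proof.
case=> P [Q [PQ QP PV]] [R [S [RS SR RW]]].
have tens1 m n : (1%:M : 'M[K]_m) *t (1%:M : 'M[K]_n) = 1%:M.
  apply/matrixP=> i j; case: (mxtens_indexP i) => i1 i2.
  case: (mxtens_indexP j) => j1 j2; rewrite tensmxE !mxE -natrM mulnb.
  by rewrite (can_eq (@mxtens_indexK _ _)) xpair_eqE.
exists (P *t R), (Q *t S); split=> [||x].
- by rewrite tensmx_mul PQ RS tens1.
- by rewrite tensmx_mul QP SR tens1.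
rewrite /= /tens_act mulmx_sumr mulmx_suml; apply: eq_bigr => p _.
by rewrite !tensmx_mul PV RW.
Qed.

Lemma hmod_tensA U V W :
  hmod_iso (hmod_tens U (hmod_tens V W)) (hmod_tens (hmod_tens U V) W).
Proof.
pose s (i : 'I_(mdim U * (mdim V * mdim W))) : 'I_(mdim U * mdim V * mdim W) :=
  let ak := mxtens_unindex i in let bc := mxtens_unindex ak.2 in
  mxtens_index (mxtens_index (ak.1, bc.1), bc.2).
pose t (i : 'I_(mdim U * mdim V * mdim W)) : 'I_(mdim U * (mdim V * mdim W)) :=
  let kc := mxtens_unindex i in let ab := mxtens_unindex kc.1 in
  mxtens_index (ab.1, mxtens_index (ab.2, kc.2)).
apply: (@hmod_iso_reindex (hmod_tens U (hmod_tens V W))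
                          (hmod_tens (hmod_tens U V) W) s t).
- move=> i; case: (mxtens_indexP i) => a k; case: (mxtens_indexP k) => b c.
  by rewrite /s /t !mxtens_indexK.
- move=> i; case: (mxtens_indexP i) => k c; case: (mxtens_indexP k) => a b.
  by rewrite /s /t !mxtens_indexK.
move=> x i j; case: (mxtens_indexP i) => a k; case: (mxtens_indexP k) => b c.
case: (mxtens_indexP j) => a' k'; case: (mxtens_indexP k') => b' c'.
rewrite /s !mxtens_indexK [LHS]summxE [RHS]summxE.
pose T (u v w : H) : K^o := U u a a' * V v b b' * W w c c'.
have trT : trilinear_map T.
  split=> [v w e u u'|u w e v v'|u v e w w']; rewrite /T linearP !mxE.
  - by rewrite !mulrDl -!mulrA.
  - by rewrite mulrDr mulrDl mulrCA -!mulrA.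
  by rewrite mulrDr mulrCA.
have := @comulA _ H x _ _ trT; rewrite !big_allpairs_dep /= => eqT.
transitivity (\sum_(p <- comul x) \sum_(r <- comul p.2) T p.1 r.1 r.2).
  apply: eq_bigr => p _; rewrite tensmxE summxE mulr_sumr.
  by apply: eq_bigr => r _; rewrite tensmxE mulrA.
rewrite -eqT; apply: eq_bigr => p _; rewrite tensmxE summxE mulr_suml.
by apply: eq_bigr => r _; rewrite tensmxE.
Qed.

Lemma hmod_tens1m V : hmod_iso (hmod_tens hmod1 V) V.
Proof.
apply: (@hmod_iso_reindex (hmod_tens hmod1 V) V (fun i => (mxtens_unindex i).2)
                              (fun i => mxtens_index (ord0, i))).
- by move=> i; case: (mxtens_indexP i) => a b; rewrite mxtens_indexK (ord1 a).
- by move=> i; rewrite mxtens_indexK.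
move=> x i j; case: (mxtens_indexP i) => a b; case: (mxtens_indexP j) => a' b'.
rewrite !mxtens_indexK [LHS]summxE -{2}(counit_l x) linear_sum summxE.
apply: eq_bigr => p _.
by rewrite tensmxE linearZ /= (ord1 a) (ord1 a') !mxE mulr1n.
Qed.

Lemma hmod_tensm1 V : hmod_iso (hmod_tens V hmod1) V.
Proof.
apply: (@hmod_iso_reindex (hmod_tens V hmod1) V (fun i => (mxtens_unindex i).1)
                              (fun i => mxtens_index (i, ord0))).
- by move=> i; case: (mxtens_indexP i) => a b; rewrite mxtens_indexK (ord1 b).
- by move=> i; rewrite mxtens_indexK.
move=> x i j; case: (mxtens_indexP i) => a b; case: (mxtens_indexP j) => a' b'.
rewrite !mxtens_indexK [LHS]summxE -{2}(counit_r x) linear_sum summxE.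
apply: eq_bigr => p _.
by rewrite tensmxE linearZ /= (ord1 b) (ord1 b') !mxE mulr1n mulrC.
Qed.

Lemma hmod_tensDl U V W : hmod_iso (hmod_tens (hmod_sum U V) W)
  (hmod_sum (hmod_tens U W) (hmod_tens V W)).
Proof.
pose s (i : 'I_((mdim U + mdim V) * mdim W)) :
       'I_(mdim U * mdim W + mdim V * mdim W) :=
  let kc := mxtens_unindex i in
  match split kc.1 with
  | inl a => lshift _ (mxtens_index (a, kc.2))
  | inr b => rshift _ (mxtens_index (b, kc.2))
  end.
pose t (i : 'I_(mdim U * mdim W + mdim V * mdim W)) :
       'I_((mdim U + mdim V) * mdim W) :=
  match split i with
  | inl k => let ac := mxtens_unindex k in mxtens_index (lshift _ ac.1, ac.2)
  | inr k => let bc := mxtens_unindex k in mxtens_index (rshift _ bc.1, bc.2)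
  end.
apply: (@hmod_iso_reindex (hmod_tens (hmod_sum U V) W)
  (hmod_sum (hmod_tens U W) (hmod_tens V W)) s t).
- move=> i; case: (mxtens_indexP i) => k c; rewrite /s mxtens_indexK.
  by case: (split_ordP k) => a ->; rewrite ?(unsplitK (inl _)) ?(unsplitK (inr _)) /t
    ?(unsplitK (inl _)) ?(unsplitK (inr _)) mxtens_indexK.
- move=> i; rewrite /t; case: (split_ordP i) => k ->; case: (mxtens_indexP k) => a c.
    by rewrite mxtens_indexK /s mxtens_indexK (unsplitK (inl _)).
  by rewrite mxtens_indexK /s mxtens_indexK (unsplitK (inr _)).
move=> x i j; case: (mxtens_indexP i) => k c; case: (mxtens_indexP j) => k' c'.
rewrite /s !mxtens_indexK [LHS]summxE.
under eq_bigr do rewrite tensmxE.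
case: (split_ordP k) => a ->; case: (split_ordP k') => a' ->;
  rewrite ?(unsplitK (inl _)) ?(unsplitK (inr _)).
- rewrite [RHS]block_mxEul [RHS]summxE.
  by apply: eq_bigr => p _; rewrite tensmxE [X in X * _]block_mxEul.
- rewrite [RHS]block_mxEur mxE big1 // => p _.
  by rewrite [X in X * _]block_mxEur mxE mul0r.
- rewrite [RHS]block_mxEdl mxE big1 // => p _.
  by rewrite [X in X * _]block_mxEdl mxE mul0r.
rewrite [RHS]block_mxEdr [RHS]summxE.
by apply: eq_bigr => p _; rewrite tensmxE [X in X * _]block_mxEdr.
Qed.

Lemma hmod_tensDr U V W : hmod_iso (hmod_tens W (hmod_sum U V))
  (hmod_sum (hmod_tens W U) (hmod_tens W V)).
Proof.
pose s (i : 'I_(mdim W * (mdim U + mdim V))) :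
       'I_(mdim W * mdim U + mdim W * mdim V) :=
  let ck := mxtens_unindex i in
  match split ck.2 with
  | inl a => lshift _ (mxtens_index (ck.1, a))
  | inr b => rshift _ (mxtens_index (ck.1, b))
  end.
pose t (i : 'I_(mdim W * mdim U + mdim W * mdim V)) :
       'I_(mdim W * (mdim U + mdim V)) :=
  match split i with
  | inl k => let ca := mxtens_unindex k in mxtens_index (ca.1, lshift _ ca.2)
  | inr k => let cb := mxtens_unindex k in mxtens_index (cb.1, rshift _ cb.2)
  end.
apply: (@hmod_iso_reindex (hmod_tens W (hmod_sum U V))
  (hmod_sum (hmod_tens W U) (hmod_tens W V)) s t).
- move=> i; case: (mxtens_indexP i) => c k; rewrite /s mxtens_indexK.
  by case: (split_ordP k) => a ->; rewrite ?(unsplitK (inl _)) ?(unsplitK (inr _)) /t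
    ?(unsplitK (inl _)) ?(unsplitK (inr _)) mxtens_indexK.
- move=> i; rewrite /t; case: (split_ordP i) => k ->; case: (mxtens_indexP k) => c a.
    by rewrite mxtens_indexK /s mxtens_indexK (unsplitK (inl _)).
  by rewrite mxtens_indexK /s mxtens_indexK (unsplitK (inr _)).
move=> x i j; case: (mxtens_indexP i) => c k; case: (mxtens_indexP j) => c' k'.
rewrite /s !mxtens_indexK [LHS]summxE.
under eq_bigr do rewrite tensmxE.
case: (split_ordP k) => a ->; case: (split_ordP k') => a' ->;
  rewrite ?(unsplitK (inl _)) ?(unsplitK (inr _)).
- rewrite [RHS]block_mxEul [RHS]summxE.
  by apply: eq_bigr => p _; rewrite tensmxE [X in _ * X]block_mxEul.
- rewrite [RHS]block_mxEur mxE big1 // => p _.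
  by rewrite [X in _ * X]block_mxEur mxE mulr0.
- rewrite [RHS]block_mxEdl mxE big1 // => p _.
  by rewrite [X in _ * X]block_mxEdl mxE mulr0.
rewrite [RHS]block_mxEdr [RHS]summxE.
by apply: eq_bigr => p _; rewrite tensmxE [X in _ * X]block_mxEdr.
Qed.

(** The free abelian group on the (isomorphism classes of) modules is divided by
    the smallest subgroup containing [V] - [W] for [V] and [W] isomorphic, and
    [V (+) W] - [V] - [W] for all [V], [W]. *)
Local Notation freemod := {freeg hmod / int}.
Definition fgen (V : hmod) : freemod := [freeg [:: (1, V)]].

Definition green_relator (a : freemod) : Prop :=
  (exists V W, hmod_iso V W /\ a = fgen V - fgen W) \/
  (exists V W, a = fgen (hmod_sum V W) - fgen V - fgen W).

Definition green_rel : {pred freemod} := fun a =>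
  `[< forall S : {pred freemod}, zmod_closed S ->
        (forall b, green_relator b -> b \in S) -> a \in S >].

Fact green_rel_zmod_closed : zmod_closed green_rel.
Proof.
split; first by apply/asboolP => S [].
move=> a b /asboolP Sa /asboolP Sb; apply/asboolP => S S_zmod Srel.
by apply: S_zmod.2; [apply: Sa | apply: Sb].
Qed.

HB.instance Definition _ :=
  GRing.isZmodClosed.Build freemod green_rel green_rel_zmod_closed.

Lemma green_relP a : green_relator a -> a \in green_rel.
Proof. by move=> ra; apply/asboolP => S _; apply. Qed.

Lemma green_rel_iso V W : hmod_iso V W -> fgen V - fgen W \in green_rel.
Proof. by move=> VW; apply: green_relP; left; exists V, W. Qed.

Lemma green_rel_sum V W : fgen (hmod_sum V W) - fgen V - fgen W \in green_rel.
Proof. by apply: green_relP; right; exists V, W. Qed.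

Lemma green_rel_ind (S : {pred freemod}) : zmod_closed S ->
  (forall b, green_relator b -> b \in S) -> {subset green_rel <= S}.
Proof. by move=> S_zmod Srel a /asboolP; apply. Qed.

Definition green : Type := Quotient.quot green_rel.
HB.instance Definition _ := GRing.Zmodule.on green.

Definition gclass (V : hmod) : green := \pi_green (fgen V).

(** Biadditive extension of [[V][W] = [V (x) W]] *)
Definition free_mul (a b : freemod) : freemod :=
  fglift (fun V => fglift (fun W => fgen (hmod_tens V W)) b) a.

Lemma green_eq (a b : freemod) : (\pi_green a = \pi_green b) <-> (a - b \in green_rel).
Proof. by rewrite Quotient.idealrBE; split=> [->|/eqP]. Qed.

Lemma fgliftB (M : lmodType int) (f : hmod -> M) : zmod_morphism (fglift f).
Proof. exact: lift_is_additive. Qed.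

Lemma fglift_gen (M : lmodType int) (f : hmod -> M) V : fglift f (fgen V) = f V.
Proof. by rewrite liftU scale1r. Qed.

Lemma freemod_ind (P : freemod -> Prop) :
  P 0 -> (forall V, P (fgen V)) -> (forall a b, P a -> P b -> P (a - b)) ->
  forall a, P a.
Proof.
move=> P0 Pgen PB.
have PN a : P a -> P (- a) by rewrite -sub0r; apply: PB.
have PD a b : P a -> P b -> P (a + b) by rewrite -[b in a + b]opprK => ? ?; apply/PB/PN.
have Pn a n : P a -> P (a *+ n) by move=> Pa; elim: n => // n IH; rewrite mulrS; apply: PD.
apply: freeg_ind_dom0 => // k V D _ _; apply: PD.
have ->: [freeg [:: (k, V)]] = fgen V *~ k by rewrite freegU_mulz intz.
by case: k => n; [apply: Pn | apply/PN/Pn].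
Qed.

Lemma free_mulBl : left_distributive free_mul (fun a b => a - b).
Proof. by move=> a b c; rewrite /free_mul fgliftB. Qed.

Lemma free_mulBr : right_distributive free_mul (fun a b => a - b).
Proof.
move=> c a b; elim/freemod_ind: c => [|V|c c' IH IH'].
- by rewrite -(subrr (0 : freemod)) !free_mulBl !subrr.
- by rewrite /free_mul !fglift_gen fgliftB.
by rewrite !free_mulBl IH IH' !opprB addrACA [RHS]addrACA [- _ + _]addrC.
Qed.

Lemma free_mul_gen V W : free_mul (fgen V) (fgen W) = fgen (hmod_tens V W).
Proof. by rewrite /free_mul !fglift_gen. Qed.

Lemma free_mul0l a : free_mul 0 a = 0.
Proof. by rewrite -(subrr (0 : freemod)) free_mulBl !subrr. Qed.

Lemma free_mul0r a : free_mul a 0 = 0.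
Proof. by rewrite -(subrr (0 : freemod)) free_mulBr !subrr. Qed.

Lemma free_mul_rell a b : a \in green_rel -> free_mul a b \in green_rel.
Proof.
elim/freemod_ind: b a => [|W|b b' IH IH'] a ra.
- by rewrite free_mul0r rpred0.
- pose S := [pred x | free_mul x (fgen W) \in green_rel].
  suff: a \in S by [].
  move: a ra; apply: green_rel_ind => [|x [[V [V' [VV' ->]]]|[V [V' ->]]]].
  + split=> [|x y]; rewrite !inE; first by rewrite free_mul0l rpred0.
    by rewrite free_mulBl; apply: rpredB.
  + rewrite inE free_mulBl !free_mul_gen; apply: green_rel_iso.
    exact: hmod_iso_tens (hmod_iso_refl _).
  rewrite inE !free_mulBl !free_mul_gen.
  have := rpredD (green_rel_iso (hmod_tensDl V V' W))
                 (green_rel_sum (hmod_tens V W) (hmod_tens V' W)).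
  by rewrite !addrA subrK.
by rewrite free_mulBr rpredB ?IH ?IH'.
Qed.

Lemma free_mul_relr a b : b \in green_rel -> free_mul a b \in green_rel.
Proof.
elim/freemod_ind: a b => [|W|a a' IH IH'] b rb.
- by rewrite free_mul0l rpred0.
- pose S := [pred x | free_mul (fgen W) x \in green_rel].
  suff: b \in S by [].
  move: b rb; apply: green_rel_ind => [|x [[V [V' [VV' ->]]]|[V [V' ->]]]].
  + split=> [|x y]; rewrite !inE; first by rewrite free_mul0r rpred0.
    by rewrite free_mulBr; apply: rpredB.
  + rewrite inE free_mulBr !free_mul_gen; apply: green_rel_iso.
    exact: hmod_iso_tens (hmod_iso_refl _) _.
  rewrite inE !free_mulBr !free_mul_gen.
  have := rpredD (green_rel_iso (hmod_tensDr V V' W))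
                 (green_rel_sum (hmod_tens W V) (hmod_tens W V')).
  by rewrite !addrA subrK.
by rewrite free_mulBl rpredB ?IH ?IH'.
Qed.

Definition green_mul (x y : green) : green := \pi_green (free_mul (repr x) (repr y)).

Lemma green_mul_pi a b : green_mul (\pi_green a) (\pi_green b) = \pi_green (free_mul a b).
Proof.
apply/green_eq; set a' := repr _; set b' := repr _.
have aa': a' - a \in green_rel by apply/green_eq; rewrite reprK.
have bb': b' - b \in green_rel by apply/green_eq; rewrite reprK.
have := rpredD (free_mul_rell b' aa') (free_mul_relr a bb').
by rewrite free_mulBl free_mulBr addrA subrK.
Qed.

Lemma green_ind (P : green -> Prop) :
  P 0 -> (forall V, P (gclass V)) -> (forall a b, P a -> P b -> P (a - b)) ->
  forall x, P x.
Proof.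
move=> P0 PV PB; elim/quotW; elim/freemod_ind => [|//|a b Pa Pb].
  by rewrite raddf0.
by rewrite raddfB; apply: PB.
Qed.

Lemma green_mulBl : left_distributive green_mul (fun a b => a - b).
Proof.
elim/quotW=> a; elim/quotW=> b; elim/quotW=> c.
by rewrite -raddfB !green_mul_pi free_mulBl raddfB.
Qed.

Lemma green_mulBr : right_distributive green_mul (fun a b => a - b).
Proof.
elim/quotW=> a; elim/quotW=> b; elim/quotW=> c.
by rewrite -raddfB !green_mul_pi free_mulBr raddfB.
Qed.

Lemma green_mul0l x : green_mul 0 x = 0.
Proof. by rewrite -(subrr (0 : green)) green_mulBl !subrr. Qed.

Lemma green_mul0r x : green_mul x 0 = 0.
Proof. by rewrite -(subrr (0 : green)) green_mulBr !subrr. Qed.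

Lemma gclass_iso V W : hmod_iso V W -> gclass V = gclass W.
Proof. by move=> VW; apply/green_eq/green_rel_iso. Qed.

Lemma gclass_sum V W : gclass (hmod_sum V W) = gclass V + gclass W.
Proof.
rewrite -raddfD; apply/green_eq; rewrite opprD addrA; exact: green_rel_sum.
Qed.

Lemma green_mul_class V W : green_mul (gclass V) (gclass W) = gclass (hmod_tens V W).
Proof. by rewrite green_mul_pi free_mul_gen. Qed.

Fact green_mulDl : left_distributive green_mul +%R.
Proof. by move=> x y z; rewrite -[y in LHS]opprK green_mulBl -sub0r green_mulBl green_mul0l sub0r opprK. Qed.

Fact green_mulDr : right_distributive green_mul +%R.
Proof. by move=> x y z; rewrite -[z in LHS]opprK green_mulBr -sub0r green_mulBr green_mul0r sub0r opprK. Qed.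

Fact green_mulA : associative green_mul.
Proof.
elim/green_ind=> [|U|x x' IH IH'] y z.
- by rewrite !green_mul0l.
- elim/green_ind: y => [|V|y y' IH IH'].
  + by rewrite green_mul0r !green_mul0l green_mul0r.
  + elim/green_ind: z => [|W|z z' IH IH'].
    * by rewrite !green_mul0r.
    * by rewrite !green_mul_class; apply/gclass_iso/hmod_tensA.
    by rewrite !green_mulBr IH IH'.
  by rewrite !(green_mulBr, green_mulBl) IH IH'.
by rewrite !green_mulBl IH IH'.
Qed.

Fact green_mul1l : left_id (gclass hmod1) green_mul.
Proof.
elim/green_ind=> [|V|x y IHx IHy]; first exact: green_mul0r.
  by rewrite green_mul_class; apply/gclass_iso/hmod_tens1m.
by rewrite green_mulBr IHx IHy.
Qed.

Fact green_mul1r : right_id (gclass hmod1) green_mul.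
Proof.
elim/green_ind=> [|V|x y IHx IHy]; first exact: green_mul0l.
  by rewrite green_mul_class; apply/gclass_iso/hmod_tensm1.
by rewrite green_mulBl IHx IHy.
Qed.

Lemma green_eq_inv (M : lmodType int) (f : hmod -> M) a b :
    (forall V W, hmod_iso V W -> f V = f W) ->
    (forall V W, f (hmod_sum V W) = f V + f W) ->
  \pi_green a = \pi_green b -> fglift f a = fglift f b.
Proof.
move=> fiso fsum /green_eq ab; apply/eqP; rewrite -subr_eq0 -fgliftB.
pose S := [pred x | fglift f x == 0].
suff: a - b \in S by [].
move: (a - b) ab; apply: green_rel_ind => [|x [[V [W [VW ->]]]|[V [W ->]]]].
- split=> [|x y]; rewrite !inE; first by rewrite -(subrr (0 : freemod)) fgliftB subrr.
  by rewrite fgliftB => /eqP-> /eqP->; rewrite subrr.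
- by rewrite inE fgliftB !fglift_gen (fiso _ _ VW) subrr.
by rewrite inE !fgliftB !fglift_gen fsum addrAC addrK subrr.
Qed.

Fact green_1neq0 : gclass hmod1 != 0.
Proof.
apply/eqP=> e; have {e}: \pi_green (fgen hmod1) = \pi_green 0 by rewrite raddf0.
move/(@green_eq_inv int^o (fun V => (mdim V)%:R)).
rewrite fglift_gen -(subrr (0 : freemod)) fgliftB subrr => H0.
suff: (1 : int) = 0 by [].
by apply: H0 => [V W /hmod_iso_dim->|V W] //; rewrite natrD.
Qed.

HB.instance Definition _ := GRing.Zmodule_isNzRing.Build green
  green_mulA green_mul1l green_mul1r green_mulDl green_mulDr green_1neq0.

Lemma gclassM V W : gclass V * gclass W = gclass (hmod_tens V W).
Proof. exact: green_mul_class. Qed.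

Lemma gclass1 : gclass hmod1 = 1.
Proof. by []. Qed.

End Modules.

Section Taft.
Variables (K : fieldType) (n d : nat) (q : K).

Definition taft_rel (A : algType K) (a b : A) : Prop :=
  [/\ a ^+ n = 1, b ^+ d = 0 & b * a = q *: (a * b)].

(** [A] is the [K]-algebra generated by [g] and [h] subject to [taft_rel]. *)
Definition taft_presented (A : algType K) (g h : A) : Prop :=
  taft_rel g h /\
  forall (B : algType K) (a b : B), taft_rel a b ->
    exists f : {lrmorphism A -> B},
      [/\ f g = a, f h = b &
          forall f' : {lrmorphism A -> B}, f' g = a -> f' h = b -> f' =1 f].

(** [H] is the Hopf algebra [H_{n,d}(q)] with its generators [g] and [h]; the
    inverse of [g] is [g ^+ n.-1]. *)
Record is_gen_taft (H : hopfAlg K) (g h : H) : Prop := IsGenTaft {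
  taft_gens : taft_presented g h;
  taft_comul_g : tens2_eq (comul g) [:: (g, g)];
  taft_comul_h : tens2_eq (comul h) [:: (1, h); (h, g)];
  taft_counit_g : counit g = 1;
  taft_counit_h : counit h = 0;
  taft_antipode_g : antipode g = g ^+ n.-1;
  taft_antipode_h : antipode h = - (q^-1 *: (g ^+ n.-1 * h))
}.

Lemma taft_rep (A : algType K) (g h : A) (k : nat) (a b : 'M[K]_k) :
  taft_presented g h -> [/\ a ^+ n = 1, b ^+ d = 0 & b * a = q *: (a * b)] ->
  exists f : {lrmorphism A -> 'M[K]_k}, f g = a /\ f h = b.
Proof.
case=> _; case: k => [|k] in a b * => AP ab; last first.
  by have [f [fg fh _]] := AP _ a b ab; exists f.
pose f (x : A) : 'M[K]_0 := 0.
have fl : linear f by move=> c x y; apply/matrixP; case.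
have fm : monoid_morphism f by split=> [|x y]; apply/matrixP; case.
pose fL := GRing.isLinear.Build K A 'M[K]_0 _ f fl.
pose fM := GRing.isMonoidMorphism.Build A 'M[K]_0 f fm.
pose F : {lrmorphism A -> 'M[K]_0} := HB.pack f fL fM.
by exists F; split; apply/matrixP; case.
Qed.

Variables (H : hopfAlg K) (g h : H) (taftH : is_gen_taft g h).
Variables (omega : K) (prim_omega : n.-primitive_root omega).
Hypothesis omega_q : omega ^+ (n %/ d) = q.

(** The matrices of [g] and [h] on [M(l,i)] in the basis [v_0, ..., v_(l-1)]:
    column [j] is the image of [v_j]. *)
Definition taftM_g (l : nat) (i : 'Z_n) : 'M[K]_l :=
  diag_mx (\row_j (omega ^+ i * q ^- j)).
Definition taftM_h (l : nat) : 'M[K]_l :=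
  \matrix_(a, j) (a == j.+1 :> nat)%:R.

Fact taftM_rel l (i : 'Z_n) (a := taftM_g l i) (b := taftM_h l) : (l <= d)%N ->
  [/\ a ^+ n = 1, b ^+ d = 0 & b * a = q *: (a * b)].
Proof.
move=> le_l_d.
have om1 := prim_expr_order prim_omega.
have q1 : q ^+ n = 1 by rewrite -omega_q exprAC om1 expr1n.
have q0 : q != 0.
  apply/eqP=> q0; move: q1; rewrite q0 expr0n gtn_eqF ?(prim_order_gt0 prim_omega) //.
  by move/esym/eqP; rewrite oner_eq0.
have diagX k : a ^+ k = diag_mx (\row_j (omega ^+ i * q ^- j) ^+ k).
  elim: k => [|k IH].
    by rewrite expr0; apply/matrixP=> u v; rewrite !mxE expr0.
  rewrite exprS IH [LHS]mulmx_diag; congr diag_mx; apply/rowP=> j.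
  by rewrite !mxE exprS.
have shiftX k : b ^+ k = \matrix_(u, v) (u == (v + k)%N :> nat)%:R.
  elim: k => [|k IH].
    by rewrite expr0; apply/matrixP=> u v; rewrite !mxE addn0.
  rewrite exprSr IH; apply/matrixP=> u v; rewrite mxE [RHS]mxE.
  have [lt_v|ge_v] := ltnP v.+1 l.
    rewrite (bigD1 (Ordinal lt_v)) //= !mxE eqxx mulr1 addSnnS big1 ?addr0 // => w.
    by rewrite -val_eqE !mxE /= => /negPf->; rewrite mulr0.
  rewrite big1 => [|w _]; last by rewrite !mxE (ltn_eqF (leq_trans (ltn_ord w) ge_v)) mulr0.
  by rewrite ltn_eqF // (leq_trans (ltn_ord u)) // addnS -addSn (leq_trans ge_v) ?leq_addr.
split.
- rewrite diagX; apply/matrixP=> u v; rewrite !mxE exprMn exprAC om1 expr1n mul1r.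
  by rewrite exprVn -exprM mulnC exprM q1 expr1n invr1.
- rewrite shiftX; apply/matrixP=> u v; rewrite !mxE.
  by rewrite ltn_eqF // (leq_trans (ltn_ord u)) // (leq_trans le_l_d) ?leq_addl.
rewrite [LHS]mul_mx_diag [X in q *: X]mul_diag_mx; apply/matrixP=> u v; rewrite !mxE.
have [->|] := eqVneq (u : nat) v.+1; last by rewrite mul0r !mulr0.
rewrite mul1r mulr1 exprS invfM mulrCA; congr (_ * _).
by rewrite mulrA mulfV // mul1r.
Qed.

Definition taftM l (i : 'Z_n) (le_l_d : (l <= d)%N) : hmod H :=
  HMod (sval (cid (taft_rep (taft_gens taftH) (taftM_rel i le_l_d)))).

Lemma taftM_actg l (i : 'Z_n) (le_l_d : (l <= d)%N) :
  taftM i le_l_d g = taftM_g l i.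
Proof. by rewrite /taftM /=; case: cid => f []. Qed.

Lemma taftM_acth l (i : 'Z_n) (le_l_d : (l <= d)%N) :
  taftM i le_l_d h = taftM_h l.
Proof. by rewrite /taftM /=; case: cid => f []. Qed.

End Taft.

(** [Z[y,z]] is [{poly {poly int}}], with [y] the inner and [z] the outer
    variable. *)

Definition polyy : {poly {poly int}} := 'X%:P.
Definition polyz : {poly {poly int}} := 'X.

Fixpoint gfib (s : nat) : {poly {poly int}} :=
  if s is s1.+1 then
    if s1 is s0.+1 then polyz * gfib s1 - polyy * gfib s0 else 1
  else 0.

(** The substitution [F(y,z) |-> F(y^m,z)] *)
Definition subst_ym (m : nat) (p : {poly {poly int}}) : {poly {poly int}} :=
  map_poly (comp_poly 'X^m) p.

Section TaftIdeal.
Variables n d : nat.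
Local Notation m := (n %/ d)%N.

Definition taft_ideal : {pred {poly {poly int}}} := fun p =>
  `[< exists a b, p = a * (polyy ^+ n - 1) +
                      b * ((polyz - polyy ^+ m - 1) * subst_ym m (gfib d)) >].

Fact taft_ideal_closed : idealr_closed taft_ideal.
Proof.
split.
- by apply/asboolP; exists 0, 0; rewrite !mul0r addr0.
- apply/asboolP => -[a [b /(congr1 (fun p => p.[2%:R].[1]))]].
  rewrite !(hornerD, hornerM, horner_exp, hornerN, hornerX, hornerC) !expr1n.
  by rewrite -?polyC_natr !hornerE /= addrK subrr mulr0 mul0r => /eqP; rewrite oner_eq0.
move=> c p p' /asboolP[a [b ->]] /asboolP[a' [b' ->]]; apply/asboolP.
exists (c * a + a'), (c * b + b').
by set r1 := _ - 1; set r2 := _ * subst_ym _ _; rewrite mulrDr !mulrA !mulrDl addrACA.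
Qed.

HB.instance Definition _ := isIdealr.Build _ taft_ideal taft_ideal_closed.

End TaftIdeal.

Definition pcls (n d : nat) (p : {poly {poly int}}) :
    {ideal_quot (taft_ideal n d)} :=
  \pi_({ideal_quot (taft_ideal n d)}) p.

(* Main.v *)
Require Import Defs.
From mathcomp Require Import all_boot all_order all_algebra.
From HB Require Import structures.
From mathcomp Require Import boolp mxtens freeg ring.
Import GRing.Theory.
Local Open Scope ring_scope.

(** Write [M_s] for [M(s,0)] and [Y = [M(1,-1)]].  The tensor product of [M_2]
    and [M_s] is generated by two chains [v, h v, h^2 v, ...] of weight vectors,
    whence [[M_2][M_s] = [M_(s+1)] + Y^m [M_(s-1)]] for [s < d], because the
    quantum integer [1 + q^-1 + ... + q^-(s-1)] is then nonzero, and
    [[M_2][M_d] = [M_d] + Y^m [M_d]], because it vanishes for [s = d].  Hence the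
    evaluation [y |-> Y], [z |-> [M_2]] factors through the quotient, sends
    [F_s(y^m,z)] to [[M_s]], and sends the spanning family [y^(-i) F_l(y^m,z)]
    ([1 <= l <= d], [i] in [Z_n]) to the classes [[M(l,i)]].  These generate the
    Green ring: a maximal chain in any module splits off, by pairing it with a
    chain of weight covectors.  They are independent: the ranks of [h^k e], for
    [e] the projection onto a weight space, are additive invariants from which
    the multiplicity of each [M(l,i)] can be recovered. *)

Set Implicit Arguments.
Unset Strict Implicit.
Unset Printing Implicit Defensive.

(** * Splitting off direct summands *)

Lemma idempotent_factor (F : fieldType) (N : nat) (E : 'M[F]_N) : E *m E = E ->
  exists r (A : 'M_(N, r)) (B : 'M_(r, N)), A *m B = E /\ B *m A = 1%:M.
Proof.
move=> EE; exists (\rank E), (col_base E), (row_base E).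
move: (mulmx_base E) (row_base_free E) (col_base_full E).
move: (col_base E) (row_base E) => A B AB /row_freeP[A' A'A] /row_fullP[B' B'B].
(* In the rank factorisation [E = A B], cancelling [A] on the left and [B] on the right of
   [A B A B = A B] leaves [B A = 1]. *)
have : B' *m (A *m B *m (A *m B)) *m A' = B' *m (A *m B) *m A' by rewrite AB EE.
by rewrite -!mulmxA A'A mulmx1 (mulmxA B' A) B'B mul1mx => ->.
Qed.

Section Modules.
Variables (K : fieldType) (H : hopfAlg K).
Implicit Types V W : hmod H.

Definition hmod_hom V W (P : 'M[K]_(mdim W, mdim V)) : Prop :=
  forall x, P *m V x = W x *m P.

(** [A *m B] is then an idempotent endomorphism of [V], and [f] is the action on its image in
    coordinates; multiplicativity is where the commutation enters. *)
Lemma hmod_summand V (r : nat) (A : 'M[K]_(mdim V, r)) (B : 'M[K]_(r, mdim V)) :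
    B *m A = 1%:M -> (forall x, A *m B *m V x = V x *m (A *m B)) ->
  exists f : {lrmorphism H -> 'M[K]_r}, forall x, f x = B *m V x *m A.
Proof.
move=> BA ABc; pose f (x : H) : 'M[K]_r := B *m V x *m A.
have fl : linear f.
  by move=> c x y; rewrite /f linearP /= mulmxDr mulmxDl -scalemxAr -scalemxAl.
have fm : monoid_morphism f.
  split=> [|x y]; rewrite /f; first by rewrite rmorph1 mulmx1.
  rewrite rmorphM /= -[RHS]/(_ *m _) -[V x * V y]/(_ *m _).
  by rewrite -!mulmxA (mulmxA A B) (mulmxA (A *m B)) ABc -!mulmxA BA mulmx1.
pose fL := GRing.isLinear.Build K H 'M[K]_r _ f fl.
pose fM := GRing.isMonoidMorphism.Build H 'M[K]_r f fm.
pose F : {lrmorphism H -> 'M[K]_r} := HB.pack f fL fM.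
by exists F.
Qed.

(** Correcting [Q] by the inverse of [Q *m P] gives a retraction [Q1] of [P]; the complement [W] is
    the image of the idempotent [1 - P Q1]. *)
Lemma hmod_split U V (P : 'M[K]_(mdim V, mdim U)) (Q : 'M[K]_(mdim U, mdim V)) :
    hmod_hom P -> hmod_hom Q -> Q *m P \in unitmx ->
  exists W, hmod_iso V (hmod_sum U W) /\ mdim V = (mdim U + mdim W)%N.
Proof.
move=> homP homQ0 uQP.
pose Q1 := invmx (Q *m P) *m Q.
have QP : Q1 *m P = 1%:M by rewrite -mulmxA mulVmx.
have homQ : hmod_hom Q1.
  move=> x; rewrite -mulmxA homQ0 !mulmxA; congr (_ *m _).
  rewrite -[LHS]mulmx1 -(mulmxV uQP) !mulmxA; congr (_ *m _).
  rewrite -(mulmxA _ (U x)) -homQ0 -!mulmxA -homP !mulmxA.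
  by rewrite -(mulmxA _ Q P) mulVmx // mul1mx.
pose E : 'M[K]_(mdim V) := 1%:M - P *m Q1.
have EE : E *m E = E.
  rewrite /E mulmxBl mul1mx mulmxBr mulmx1 -mulmxA (mulmxA Q1) QP.
  by rewrite mul1mx subrr subr0.
have [r [A [B [AB BA]]]] := idempotent_factor EE.
have homE : hmod_hom E.
  by move=> x; rewrite mulmxBl mulmxBr mul1mx mulmx1 -mulmxA homQ !mulmxA homP.
have [|f fE] := @hmod_summand V r A B BA; first by move=> x; rewrite AB; apply: homE.
have BP : B *m P = 0.
  rewrite -[B]mul1mx -BA -!mulmxA (mulmxA A) AB mulmxBl mul1mx -mulmxA QP.
  by rewrite mulmx1 subrr mulmx0.
have QA : Q1 *m A = 0.
  rewrite -[A]mulmx1 -BA !mulmxA -(mulmxA Q1) AB mulmxBr mulmx1 mulmxA QP.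
  by rewrite mul1mx subrr mul0mx.
have iso : hmod_iso V (hmod_sum U (HMod f)).
  exists (col_mx Q1 B), (row_mx P A); split.
  - by rewrite mul_col_row QP QA BP BA -scalar_mx_block.
  - by rewrite mul_row_col AB addrC subrK.
  move=> x; rewrite mul_col_mx [RHS]mul_block_col !mul0mx addr0 add0r.
  by rewrite homQ /= fE -2!mulmxA AB -homE mulmxA -AB !mulmxA BA mul1mx.
by exists (HMod f); split; rewrite ?(hmod_iso_dim iso).
Qed.

Lemma gclass_split U V (P : 'M[K]_(mdim V, mdim U)) (Q : 'M[K]_(mdim U, mdim V)) :
    hmod_hom P -> hmod_hom Q -> Q *m P \in unitmx ->
  exists W, gclass V = gclass U + gclass W /\ mdim V = (mdim U + mdim W)%N.
Proof.
move=> homP homQ uQP; have [W [VW dW]] := hmod_split homP homQ uQP.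
by exists W; split; rewrite // (gclass_iso VW) gclass_sum.
Qed.

(** The kernel condition says that no nonzero covector kills the image, so [P] is onto; equal
    dimensions make it bijective. *)
Lemma hmod_iso_full V W (P : 'M[K]_(mdim W, mdim V)) :
    hmod_hom P -> mdim V = mdim W ->
    (forall r : 'rV_(mdim W), r *m P = 0 -> r = 0) ->
  hmod_iso V W.
Proof.
move=> homP dVW ker0.
have free : row_free P by rewrite -kermx_eq0; apply/rowV0P => r /sub_kermxP /ker0.
have [R PR] := row_freeP free.
have [L LP] : exists L, L *m P = 1%:M.
  by apply/row_fullP; rewrite /row_full (eqP free) dVW.
exists P, R; split=> //.
by rewrite -[R]mul1mx -LP -(mulmxA L) PR mulmx1.
Qed.

(** [V (+) V] is also zero, hence isomorphic to [V], so that [2 [V] = [V]]. *)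
Lemma gclass_dim0 V : mdim V = 0%N -> gclass V = 0.
Proof.
move=> V0; suff iso : hmod_iso (hmod_sum V V) V.
  by move/gclass_iso: iso; rewrite gclass_sum => /(canRL (addrK _)); rewrite subrr.
exists 0, 0; split=> [||x]; last by rewrite mul0mx mulmx0.
  by apply/matrixP=> -[i lt_i]; exfalso; move: lt_i; rewrite V0.
rewrite mulmx0; apply/matrixP=> -[i lt_i]; exfalso.
by move: lt_i; rewrite /= V0.
Qed.

Lemma hmod_hom_row U V W (P : 'M[K]_(mdim W, mdim U)) (Q : 'M[K]_(mdim W, mdim V)) :
  hmod_hom P -> hmod_hom Q -> @hmod_hom (hmod_sum U V) W (row_mx P Q).
Proof.
move=> homP homQ x.
by rewrite [LHS]mul_row_block !mulmx0 addr0 add0r homP homQ mul_mx_row.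
Qed.

End Modules.

(** * Additive invariants as functionals on the Green ring *)

Section GreenFunctional.
Local Open Scope quotient_scope.

Lemma green_functional (K : fieldType) (H : hopfAlg K) (f : hmod H -> int) :
    (forall V W, hmod_iso V W -> f V = f W) ->
    (forall V W, f (hmod_sum V W) = f V + f W) ->
  exists F : green H -> int, zmod_morphism F /\ forall V, F (gclass V) = f V.
Proof.
move=> fiso fsum; pose f' : hmod H -> int^o := f.
pose F (x : green H) : int := fglift f' (repr x).
have Fpi a : F (\pi_(green H) a) = fglift f' a.
  by apply: (@green_eq_inv _ _ int^o f') => //; rewrite reprK.
exists F; split=> [|V]; last by rewrite Fpi fglift_gen.
by elim/quotW => a; elim/quotW => b; rewrite -raddfB !Fpi fgliftB.
Qed.

End GreenFunctional.

(** * Standard basis vectors *)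

Section BasisVectors.
Variable K : fieldType.

(** The index is any natural number and the vector is 0 from [j = l] on, so that [h] moves [v_j] to
    [v_(j+1)] with no exception at the end of the chain. *)
Definition bvec (l j : nat) : 'cV[K]_l := \col_a (a == j :> nat)%:R.

Lemma bvec_out l j : (l <= j)%N -> bvec l j = 0.
Proof.
move=> le_lj; apply/colP=> a; rewrite !mxE.
by rewrite ltn_eqF // (leq_trans (ltn_ord a)).
Qed.

Lemma taftM_h_bvec l j : taftM_h K l *m bvec l j = bvec l j.+1.
Proof.
have [lt_jl|le_lj] := ltnP j l; last by rewrite !bvec_out ?mulmx0 // leqW.
have -> : bvec l j = delta_mx (Ordinal lt_jl) 0.
  by apply/colP=> a; rewrite !mxE andbT.
by rewrite -colE; apply/colP=> a; rewrite !mxE.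
Qed.

Lemma taftM_g_bvec n l q omega (i : 'Z_n) j :
  taftM_g q omega l i *m bvec l j = (omega ^+ i * q ^- j) *: bvec l j.
Proof.
rewrite mul_diag_mx; apply/colP=> a; rewrite !mxE.
by have [->|] := eqVneq; rewrite ?mulr0.
Qed.

Lemma row_tens0 l1 l2 (r : 'rV[K]_(l1 * l2)) :
    (forall a b, (a < l1)%N -> (b < l2)%N -> r *m (bvec l1 a *t bvec l2 b) = 0) ->
  r = 0.
Proof.
move=> r0; apply/rowP=> k; case: (mxtens_indexP k) => a b.
have -> : r 0 (mxtens_index (a, b)) = (r *m (bvec l1 a *t bvec l2 b)) 0 0.
  have -> : bvec l1 a *t bvec l2 b = delta_mx (mxtens_index (a, b)) 0.
    apply/colP=> j; case: (mxtens_indexP j) => a' b'.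
    rewrite !mxE mxtens_indexK /= -natrM mulnb andbT.
    by rewrite (can_eq (@mxtens_indexK _ _)) xpair_eqE.
  by rewrite -colE mxE.
by rewrite r0 // !mxE.
Qed.

End BasisVectors.

Section Taft.
Local Open Scope quotient_scope.
Variables (K : fieldType) (n d : nat) (q omega : K).
Hypotheses (n_ge2 : (2 <= n)%N) (d_ge2 : (2 <= d)%N).
Hypotheses (prim_q : d.-primitive_root q) (prim_omega : n.-primitive_root omega).
Hypothesis omega_q : omega ^+ (n %/ d) = q.
Variables (H : hopfAlg K) (g h : H) (taftH : is_gen_taft n d q g h).
Local Notation M := (taftM taftH prim_omega omega_q).
Local Notation m := (n %/ d)%N.
Implicit Types V W : hmod H.

(** * Representations determined by the generators *)

Lemma taft_repr_eq k (f1 f2 : {lrmorphism H -> 'M[K]_k}) :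
  f1 g = f2 g -> f1 h = f2 h -> f1 =1 f2.
Proof.
(* Size 0 is separate: the universal property is applied to nonzero matrix rings only. *)
case: k f1 f2 => [|k] f1 f2 eg eh x; first by apply/matrixP; case.
have [[gn hd hg] U] := taft_gens taftH.
have [|f [_ _ uf]] := U _ (f2 g) (f2 h); last by rewrite (uf f1) // (uf f2).
split; first by rewrite -rmorphXn gn rmorph1.
  by rewrite -rmorphXn hd raddf0.
by rewrite -!rmorphM -linearZ /= hg.
Qed.

(* Conjugating W (+) V by the unipotent [[1, P], [0, 1]] yields a representation
   which agrees with W (+) V on the generators; compare the corners. *)
Lemma taft_hom V W (P : 'M[K]_(mdim W, mdim V)) :
  P *m V g = W g *m P -> P *m V h = W h *m P -> hmod_hom P.
Proof.
move=> Pg Ph.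
pose U : 'M[K]_(mdim W + mdim V) := block_mx 1%:M P 0 1%:M.
pose U' : 'M[K]_(mdim W + mdim V) := block_mx 1%:M (- P) 0 1%:M.
have UU' : U *m U' = 1%:M.
  rewrite mulmx_block !mulmx1 !mul1mx !mulmx0 !mul0mx !addr0 !add0r addNr.
  by rewrite -scalar_mx_block.
have U'U : U' *m U = 1%:M by apply: mulmx1C.
have [|f fE] := @hmod_summand _ _ (hmod_sum W V) _ U' U UU'.
  by move=> x; rewrite U'U mul1mx mulmx1.
have fB x : f x = block_mx (W x) (P *m V x - W x *m P) 0 (V x).
  rewrite fE [X in X *m _]mulmx_block [LHS]mulmx_block.
  rewrite !mulmx1 !mul1mx !mulmx0 !mul0mx !addr0 !add0r mulmxN.
  by rewrite mul0mx add0r addrC.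
have fS := @taft_repr_eq _ f (mact (hmod_sum W V)).
move=> x; apply/eqP; rewrite -subr_eq0.
have : f x = hmod_sum W V x.
  by apply: fS; rewrite fB (Pg, Ph) subrr.
by rewrite fB => /eq_block_mx[_ -> _ _].
Qed.

Lemma taft_hg j : h ^+ j * g = q ^+ j *: (g * h ^+ j).
Proof.
have [[_ _ hg] _] := taft_gens taftH.
elim: j => [|j IH]; first by rewrite !expr0 mulr1 mul1r scale1r.
by rewrite exprSr -mulrA hg -scalerAr [X in q *: X]mulrA IH -scalerAl scalerA -exprS mulrA.
Qed.

Lemma omega_mod j : omega ^+ (j %% n) = omega ^+ j.
Proof. exact: prim_expr_mod prim_omega j. Qed.

Lemma q_neq0 : q != 0.
Proof. by rewrite (prim_root_eq0 prim_q) -lt0n ltnW. Qed.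

Lemma omega_neq0 : omega != 0.
Proof. by rewrite (prim_root_eq0 prim_omega) -lt0n ltnW. Qed.

Lemma omegaD (i j : 'Z_n) : omega ^+ (i + j)%R = omega ^+ i * omega ^+ j.
Proof.
rewrite -exprD -[RHS]omega_mod; congr (_ ^+ _).
(* Addition in ['Z_n] is modulo [(Zp_trunc n).+2], which is [n] because [2 <= n]. *)
exact: (congr1 (modn (i + j)) (Zp_cast n_ge2)).
Qed.

(** * Chains of weight vectors as maps out of [M(l,i)] *)

Definition chain V (v : 'cV[K]_(mdim V)) (l : nat) : 'M[K]_(mdim V, l) :=
  \matrix_(a, j) (V (h ^+ j) *m v) a 0.

Lemma mul_chain V (v : 'cV[K]_(mdim V)) l k (X : 'M[K]_(k, mdim V)) a (j : 'I_l) :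
  (X *m chain v l) a j = (X *m (V (h ^+ j) *m v)) a 0.
Proof. by rewrite !mxE; apply: eq_bigr => b _; rewrite mxE. Qed.

Lemma mulgh V (v : 'cV[K]_(mdim V)) c j : V g *m v = c *: v ->
  V g *m (V (h ^+ j) *m v) = (c * q ^- j) *: (V (h ^+ j) *m v).
Proof.
move=> gv; have qj0 : q ^+ j != 0 by rewrite expf_neq0 ?q_neq0.
rewrite mulmxA -[V g *m _]/(V g * _) -rmorphM /=.
have -> : g * h ^+ j = q ^- j *: (h ^+ j * g) by rewrite taft_hg scalerK.
rewrite linearZ rmorphM /= -[V _ * V g]/(_ *m _) -scalemxAl -mulmxA gv.
by rewrite -scalemxAr scalerA mulrC.
Qed.

(** The weight of [v_0] and [h^l v_0 = 0] are the defining relations of [M(l,i)], so [v_0] may go to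
    any [v] satisfying them, and [v_j] then goes to [h^j v]. *)
Lemma chain_hom V (v : 'cV[K]_(mdim V)) l (i : 'Z_n) (le_l_d : (l <= d)%N) :
    V g *m v = omega ^+ i *: v -> V (h ^+ l) *m v = 0 ->
  @hmod_hom _ _ (M i le_l_d) V (chain v l).
Proof.
move=> gv hv; apply: taft_hom.
  rewrite taftM_actg mul_mx_diag; apply/matrixP=> a j.
  by rewrite mul_chain (mulgh j gv) !mxE mulrC.
rewrite taftM_acth; apply/matrixP=> a j.
rewrite mul_chain mulmxA -[V h *m _]/(V h * _) -rmorphM -exprS mxE.
have [lt_jl|le_lj] := ltnP j.+1 l.
  rewrite (bigD1 (Ordinal lt_jl)) //= [chain _ _ _ _]mxE [taftM_h _ _ _ _]mxE.
  rewrite eqxx mulr1 [X in _ + X]big1 ?addr0 // => b.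
  by rewrite [taftM_h _ _ _ _]mxE -val_eqE /= => /negPf ->; rewrite mulr0.
have -> : j.+1 = l by apply/eqP; rewrite eqn_leq le_lj ltn_ord.
rewrite hv mxE big1 // => b _.
by rewrite [taftM_h _ _ _ _]mxE (ltn_eqF (leq_trans (ltn_ord b) le_lj)) mulr0.
Qed.

Lemma row_chain0 V (v : 'cV[K]_(mdim V)) l (r : 'rV[K]_(mdim V)) :
  r *m chain v l = 0 -> forall j, (j < l)%N -> r *m (V (h ^+ j) *m v) = 0.
Proof.
move=> r0 j lt_jl; apply/matrixP=> a b; rewrite (ord1 b) -(mul_chain _ _ _ (Ordinal lt_jl)).
by rewrite r0 !mxE.
Qed.

(** The last hypothesis is spanning in dual form: a covector vanishing on the chain is 0. Spanning
    claims thus become equations between values of [r]. *)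
Lemma chain_iso V (v : 'cV[K]_(mdim V)) l (i : 'Z_n) (le_l_d : (l <= d)%N) :
    V g *m v = omega ^+ i *: v -> V (h ^+ l) *m v = 0 -> mdim V = l ->
    (forall r : 'rV_(mdim V),
      (forall j, (j < l)%N -> r *m (V (h ^+ j) *m v) = 0) -> r = 0) ->
  gclass V = gclass (M i le_l_d).
Proof.
move=> gv hv dV ker0; apply/esym/gclass_iso/(hmod_iso_full (chain_hom le_l_d gv hv)) => //.
by move=> r /row_chain0; apply: ker0.
Qed.

Lemma two_chains_iso V (v1 v2 : 'cV[K]_(mdim V)) l1 l2 (i1 i2 : 'Z_n)
      (le1 : (l1 <= d)%N) (le2 : (l2 <= d)%N) :
    V g *m v1 = omega ^+ i1 *: v1 -> V (h ^+ l1) *m v1 = 0 ->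
    V g *m v2 = omega ^+ i2 *: v2 -> V (h ^+ l2) *m v2 = 0 ->
    mdim V = (l1 + l2)%N ->
    (forall r : 'rV_(mdim V),
      (forall j, (j < l1)%N -> r *m (V (h ^+ j) *m v1) = 0) ->
      (forall j, (j < l2)%N -> r *m (V (h ^+ j) *m v2) = 0) -> r = 0) ->
  gclass V = gclass (M i1 le1) + gclass (M i2 le2).
Proof.
move=> gv1 hv1 gv2 hv2 dV ker0; rewrite -gclass_sum; apply/esym/gclass_iso.
apply: (hmod_iso_full (hmod_hom_row (chain_hom le1 gv1 hv1) (chain_hom le2 gv2 hv2))) => //.
move=> r; rewrite mul_mx_row -row_mx0 => /eq_row_mx[].
by move=> /row_chain0 r1 /row_chain0 r2; apply: ker0.
Qed.

(** * Tensor products on basis vectors *)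

Lemma tens_g V W : hmod_tens V W g = V g *t W g.
Proof.
by apply: etrans (taft_comul_g taftH (act_bilinear V W)) _; rewrite big_seq1.
Qed.

Lemma tens_h V W : hmod_tens V W h = 1%:M *t W h + V h *t W g.
Proof.
apply: etrans (taft_comul_h taftH (act_bilinear V W)) _.
by rewrite big_cons big_seq1 /= rmorph1.
Qed.

Lemma mact_exprS V (v : 'cV[K]_(mdim V)) k :
  V (h ^+ k.+1) *m v = V h *m (V (h ^+ k) *m v).
Proof. by rewrite exprS rmorphM mulmxA. Qed.

Lemma mact_expr0 V (v : 'cV[K]_(mdim V)) : V (h ^+ 0) *m v = v.
Proof. by rewrite expr0 rmorph1 mul1mx. Qed.

Lemma tens_g_vec V W (x : 'cV[K]_(mdim V)) (y : 'cV[K]_(mdim W)) :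
  hmod_tens V W g *m (x *t y) = (V g *m x) *t (W g *m y).
Proof. by rewrite tens_g tensmx_mul. Qed.

Lemma tens_h_vec V W (x : 'cV[K]_(mdim V)) (y : 'cV[K]_(mdim W)) :
  hmod_tens V W h *m (x *t y) = x *t (W h *m y) + (V h *m x) *t (W g *m y).
Proof. by rewrite tens_h mulmxDl !tensmx_mul mul1mx. Qed.

Lemma tensZl (a b c e : nat) (A : 'M[K]_(a, b)) (B : 'M[K]_(c, e)) k :
  (k *: A) *t B = k *: (A *t B).
Proof. by apply/matrixP=> i j; rewrite !mxE mulrA. Qed.

Lemma tensZr (a b c e : nat) (A : 'M[K]_(a, b)) (B : 'M[K]_(c, e)) k :
  A *t (k *: B) = k *: (A *t B).
Proof. by apply/matrixP=> i j; rewrite !mxE mulrCA. Qed.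

Lemma tens0l (a b c e : nat) (B : 'M[K]_(c, e)) :
  (0 : 'M[K]_(a, b)) *t B = 0.
Proof. by apply/matrixP=> i j; rewrite !mxE mul0r. Qed.

Lemma tens0r (a b c e : nat) (A : 'M[K]_(a, b)) :
  A *t (0 : 'M[K]_(c, e)) = 0.
Proof. by apply/matrixP=> i j; rewrite !mxE mulr0. Qed.

Section TensorBasis.
Variables (l1 l2 : nat) (i1 i2 : 'Z_n) (le1 : (l1 <= d)%N) (le2 : (l2 <= d)%N).
Local Notation T := (hmod_tens (M i1 le1) (M i2 le2)).

Definition tvec a b : 'cV[K]_(mdim T) := bvec K l1 a *t bvec K l2 b.

Lemma tvec_g a b :
  T g *m tvec a b = (omega ^+ (i1 + i2)%R * q ^- (a + b)) *: tvec a b.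
Proof.
rewrite [LHS]tens_g_vec !taftM_actg !taftM_g_bvec tensZl tensZr scalerA.
congr (_ *: _); rewrite omegaD exprD invfM.
by rewrite mulrACA.
Qed.

Lemma tvec_h a b :
  T h *m tvec a b = tvec a b.+1 + (omega ^+ i2 * q ^- b) *: tvec a.+1 b.
Proof.
by rewrite [LHS]tens_h_vec !taftM_acth taftM_actg taftM_g_bvec !taftM_h_bvec tensZr.
Qed.

Lemma tvec_out1 a b : (l1 <= a)%N -> tvec a b = 0.
Proof. by move=> le_a; rewrite /tvec bvec_out // tens0l. Qed.

Lemma tvec_out2 a b : (l2 <= b)%N -> tvec a b = 0.
Proof. by move=> le_b; rewrite /tvec (@bvec_out _ l2) // tens0r. Qed.

Lemma row_tvec0 (r : 'rV[K]_(mdim T)) :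
  (forall a b, (a < l1)%N -> (b < l2)%N -> r *m tvec a b = 0) -> r = 0.
Proof. exact: row_tens0. Qed.

End TensorBasis.

(** * Products with one-dimensional modules *)

Lemma gclass_taft1M l (i j : 'Z_n) (le1 : (1 <= d)%N) (le_l : (l <= d)%N) :
  gclass (M i le1) * gclass (M j le_l) = gclass (M (i + j) le_l).
Proof.
rewrite gclassM.
have hk k : hmod_tens (M i le1) (M j le_l) (h ^+ k) *m tvec i j le1 le_l 0 0
             = tvec i j le1 le_l 0 k.
  elim: k => [|k IH]; first exact: mact_expr0.
  by rewrite mact_exprS IH tvec_h (tvec_out1 _ _ _ _ _ (leqnn 1)) scaler0 addr0.
apply: (@chain_iso _ (tvec i j le1 le_l 0 0)).
- by rewrite tvec_g expr0 invr1 mulr1.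
- by rewrite hk tvec_out2.
- exact: mul1n.
move=> r r0; apply: row_tvec0 => -[] // b _ lt_b.
by rewrite -hk r0.
Qed.

(** Here [h^k] sends [v_0 (x) v_0] to [omega^(i k) v_k (x) v_0], the scalar coming from [g] in the
    term [h (x) g]; it is nonzero, so [v_0 (x) v_0] generates. *)
Lemma gclass_taftM1 l (i j : 'Z_n) (le1 : (1 <= d)%N) (le_l : (l <= d)%N) :
  gclass (M j le_l) * gclass (M i le1) = gclass (M (j + i) le_l).
Proof.
rewrite gclassM.
have hk k : hmod_tens (M j le_l) (M i le1) (h ^+ k) *m tvec j i le_l le1 0 0
             = (omega ^+ i) ^+ k *: tvec j i le_l le1 k 0.
  elim: k => [|k IH]; first by rewrite mact_expr0 expr0 scale1r.
  rewrite mact_exprS IH -scalemxAr tvec_h (tvec_out2 _ _ _ _ _ (leqnn 1)) add0r.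
  by rewrite expr0 invr1 mulr1 scalerA -exprSr.
apply: (@chain_iso _ (tvec j i le_l le1 0 0)).
- by rewrite tvec_g expr0 invr1 mulr1.
- by rewrite hk tvec_out1 ?scaler0.
- exact: muln1.
move=> r r0; apply: row_tvec0 => a [|//] lt_a _.
have /eqP := r0 a lt_a; rewrite hk -scalemxAr scaler_eq0.
by rewrite !expf_eq0 (negPf omega_neq0) !andbF => /eqP.
Qed.

Lemma gclass_taft10 (le1 : (1 <= d)%N) : gclass (M 0 le1) = 1.
Proof.
rewrite -gclass1; apply/esym; apply: (@chain_iso (hmod1 H) 1%:M) => //=.
- by rewrite /unit_act (taft_counit_g taftH) mulmx1 scale1r.
- by rewrite expr1 /unit_act (taft_counit_h taftH) mulmx1 raddf0.
move=> r /(_ 0%N isT); rewrite expr0 /unit_act rmorph1 !mulmx1.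
exact.
Qed.

(** * Quantum integers and products with [M(2,0)] *)

Definition qint k : K := \sum_(t < k) q ^- t.

Lemma qintS k : qint k.+1 = qint k + q ^- k.
Proof. exact: big_ord_recr. Qed.

(** Geometric sum: [q^-k - 1 = (q^-1 - 1) qint k], where [q != 1] because [2 <= d]. *)
Lemma qint_eq0 k : (qint k == 0) = (d %| k)%N.
Proof.
have q1 : q != 1.
  apply/eqP=> q1; have := prim_order_dvd prim_q 1.
  by rewrite expr1 q1 eqxx dvdn1 => /eqP d1; move: d_ge2; rewrite d1.
have qV1 : q^-1 - 1 != 0 by rewrite subr_eq0 invr_eq1.
have E : q ^- k - 1 = (q^-1 - 1) * qint k.
  by rewrite -exprVn subrX1 /qint; under eq_bigr do rewrite exprVn.
rewrite (prim_order_dvd prim_q) -[RHS](inj_eq invr_inj) invr1 -[RHS]subr_eq0 E mulf_eq0.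
by rewrite (negPf qV1).
Qed.

Section Tensor2.
Variables (s : nat) (le2 : (2 <= d)%N) (le_s : (s <= d)%N).
Local Notation T := (hmod_tens (M 0 le2) (M 0 le_s)).
Local Notation x := (tvec 0 0 le2 le_s).

(** Among the [k] steps at most one acts on the first factor; taken when the second factor is at
    [v_b] it contributes [q^-b], and these add up to [qint k]. At [k = 0] the index [k.-1] is
    harmless because [qint 0 = 0]. *)
Lemma tens2_h0 k : T (h ^+ k) *m x 0 0 = x 0 k + qint k *: x 1 k.-1.
Proof.
elim: k => [|k IH].
  by rewrite mact_expr0 /qint big_ord0 scale0r addr0.
rewrite mact_exprS IH mulmxDr -scalemxAr !tvec_h expr0 mul1r.
rewrite (@tvec_out1 _ _ _ _ _ _ 2) // scaler0 addr0 -addrA qintS scalerDl.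
congr (_ + _); rewrite addrC; congr (_ + _).
by case: (k) => //; rewrite /qint big_ord0 !scale0r.
Qed.

Lemma tens2_h1 k : T (h ^+ k) *m x 1 0 = x 1 k.
Proof.
elim: k => [|k IH]; first exact: mact_expr0.
by rewrite mact_exprS IH tvec_h (@tvec_out1 _ _ _ _ _ _ 2) // scaler0 addr0.
Qed.

(** The coefficient is chosen so that [h^(s-1)] kills this vector: in [tens2_hgen] both terms vanish
    at [k = s - 1]. *)
Definition tens2_gen : 'cV[K]_(mdim T) := x 0 1 - (qint s - 1) *: x 1 0.

Lemma tens2_hgen k :
  T (h ^+ k) *m tens2_gen = x 0 k.+1 + (qint k.+1 - qint s) *: x 1 k.
Proof.
elim: k => [|k IH].
  by rewrite mact_expr0 /tens2_gen /qint big_ord1 expr0 invr1 -scaleNr opprB.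
rewrite mact_exprS IH mulmxDr -scalemxAr !tvec_h expr0 mul1r.
rewrite (@tvec_out1 _ _ _ _ _ _ 2) // scaler0 addr0 -addrA -scalerDl.
by congr (_ + _ *: _); rewrite (qintS k.+1) addrCA addrA.
Qed.

(** The chains of [v_0 (x) v_0] and of [tens2_gen] have lengths [s + 1] and [s - 1], and span
    because [qint s] is nonzero. For [s = 1] the second summand is the zero module. *)
Lemma gclass_taft2M_lt (i : 'Z_n) (le_sS : (s.+1 <= d)%N) (le_sP : (s.-1 <= d)%N) :
    (0 < s)%N -> omega ^+ i = q^-1 ->
  gclass (M 0 le2) * gclass (M 0 le_s) = gclass (M 0 le_sS) + gclass (M i le_sP).
Proof.
move=> s_gt0 iq; rewrite gclassM.
have cs : qint s != 0 by rewrite qint_eq0 gtnNdvd.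
apply: (@two_chains_iso _ (x 0 0) tens2_gen).
- by rewrite tvec_g add0r [q ^+ _]expr0 invr1 mulr1.
- by rewrite tens2_h0 !tvec_out2 ?scaler0 ?addr0.
- rewrite /tens2_gen mulmxBr -scalemxAr !tvec_g add0r expr0 mul1r expr1 iq.
  by rewrite scalerBr !scalerA [_ * q^-1]mulrC.
- rewrite tens2_hgen prednK // subrr scale0r addr0 tvec_out2 //.
- by rewrite /= mul2n -addnn addSn -addnS prednK.
move=> r r0 ru.
have R0 k : (k <= s)%N -> r *m x 0 k = - qint k *: (r *m x 1 k.-1).
  rewrite -ltnS => /r0; rewrite tens2_h0 mulmxDr -scalemxAr => /eqP.
  by rewrite addr_eq0 scaleNr => /eqP.
(* For [b = s - 1], [x 0 s = 0] forces the value to vanish; for smaller [b], the two chains both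
   express [r *m x 0 b.+1], and their difference is [qint s] times the value. *)
have R1 b : (b < s)%N -> r *m x 1 b = 0.
  rewrite -[X in (_ < X)%N](prednK s_gt0) ltnS leq_eqVlt => /predU1P[->|lt_b].
    have := R0 s (leqnn s); rewrite tvec_out2 // mulmx0 => /esym/eqP.
    by rewrite scaler_eq0 oppr_eq0 (negPf cs) => /eqP.
  have := ru b lt_b; rewrite tens2_hgen mulmxDr -scalemxAr R0; last first.
    by rewrite (leq_trans lt_b) ?leq_pred.
  rewrite -scalerDl /= addrA addNr add0r => /eqP.
  by rewrite scaler_eq0 oppr_eq0 (negPf cs) => /eqP.
apply: row_tvec0 => -[|[|//]] b _ lt_b; last exact: R1.
by rewrite R0 1?ltnW // R1 ?scaler0 // (leq_ltn_trans (leq_pred b)).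
Qed.

End Tensor2.

(** Since [qint d = 0], the chain of [v_0 (x) v_0] already stops after [d] steps, and [v_1 (x) v_0]
    generates a second chain of length [d]. *)
Lemma gclass_taft2M_top (i : 'Z_n) (le2 : (2 <= d)%N) (le_d : (d <= d)%N) :
    omega ^+ i = q^-1 ->
  gclass (M 0 le2) * gclass (M 0 le_d) = gclass (M 0 le_d) + gclass (M i le_d).
Proof.
move=> iq; rewrite gclassM.
have cd : qint d = 0 by apply/eqP; rewrite qint_eq0.
pose x := tvec 0 0 le2 le_d.
apply: (@two_chains_iso _ (x 0%N 0%N) (x 1%N 0%N)).
- by rewrite tvec_g add0r [q ^+ _]expr0 invr1 mulr1.
- by rewrite tens2_h0 cd scale0r addr0 tvec_out2.
- by rewrite tvec_g add0r expr0 mul1r expr1 iq.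
- by rewrite tens2_h1 tvec_out2.
- by rewrite /= mul2n -addnn.
move=> r r0 r1.
have R1 b : (b < d)%N -> r *m x 1%N b = 0 by move=> /r1; rewrite tens2_h1.
apply: row_tvec0 => -[|[|//]] b _ lt_b; last exact: R1.
have := r0 b lt_b; rewrite tens2_h0 mulmxDr -scalemxAr.
by rewrite R1 ?scaler0 ?addr0 // (leq_ltn_trans (leq_pred b)).
Qed.

(** * Projections [idem lam] onto the eigenspaces of [g] *)

Definition idem (lam : K) : H := n%:R^-1 *: \sum_(j < n) (lam^-1 *: g) ^+ j.

Lemma omegaXn i : (omega ^+ i) ^+ n = 1.
Proof. by rewrite exprAC (prim_expr_order prim_omega) expr1n. Qed.

Lemma qXn : q ^+ n = 1.
Proof. by rewrite -omega_q omegaXn. Qed.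

Lemma root1_neq0 (lam : K) : lam ^+ n = 1 -> lam != 0.
Proof.
move=> lamn; have : lam ^+ n != 0 by rewrite lamn oner_neq0.
by rewrite expf_eq0 negb_and -leqNgt leqNgt (ltnW n_ge2).
Qed.

(** For [u = lam^-1 g] one has [u^n = 1], so [u - 1] annihilates [1 + u + ... + u^(n-1)]. *)
Lemma idemg lam : lam ^+ n = 1 -> idem lam * g = lam *: idem lam.
Proof.
move=> lamn; have lam0 := root1_neq0 lamn; have [[gn _ _] _] := taft_gens taftH.
have cS : GRing.comm g (\sum_(j < n) (lam^-1 *: g) ^+ j).
  by apply: commr_sum => j _; apply: commrX; rewrite /GRing.comm -scalerAl -scalerAr.
have : (lam^-1 *: g) ^+ n - 1 = 0 by rewrite exprZn gn exprVn lamn invr1 scale1r subrr.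
rewrite subrX1 mulrBl mul1r -scalerAl => /eqP; rewrite subr_eq0 => /eqP E.
by rewrite /idem -scalerAl -cS -[in RHS]E !scalerA mulrAC mulfV // mul1r.
Qed.

(** After exchanging the sums, the coefficient of [g^j] is the mean of [omega^(-i j)] over [i]: 1
    for [j = 0], otherwise 0. *)
Lemma sum_idem : \sum_(i < n) idem (omega ^+ i) = 1.
Proof.
have n0 : n%:R != 0 :> K by rewrite (prim_root_natf_neq0 prim_omega).
rewrite -scaler_sumr exchange_big /=.
rewrite (bigD1 (Ordinal (ltnW n_ge2))) //= [X in _ + X]big1 => [|j j0].
  under eq_bigr do rewrite expr0.
  by rewrite addr0 sumr_const card_ord -scaler_nat scalerA mulVf // scale1r.
under eq_bigr do rewrite exprZn exprVn exprAC -exprVn.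
rewrite -scaler_suml.
set x := (omega ^+ j)^-1.
have x1 : x - 1 != 0.
  rewrite subr_eq0 invr_eq1 -(prim_order_dvd prim_omega) gtnNdvd //.
  by rewrite lt0n; apply: contraNneq j0 => j0; rewrite -val_eqE /= j0.
suff -> : \sum_(i < n) x ^+ i = 0 by rewrite scale0r.
by apply: (mulfI x1); rewrite -subrX1 mulr0 exprVn omegaXn invr1 subrr.
Qed.

Lemma idem_vec V (v : 'cV[K]_(mdim V)) (mu : K) : mu != 0 ->
  V g *m v = mu *: v -> V (idem mu) *m v = v.
Proof.
move=> mu0 gv; have n0 : n%:R != 0 :> K by rewrite (prim_root_natf_neq0 prim_omega).
rewrite /idem linearZ /= linear_sum -scalemxAl mulmx_suml.
rewrite (eq_bigr (fun=> v)) => [|j _].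
  by rewrite sumr_const card_ord -scaler_nat scalerA mulVf // scale1r.
elim: (j : nat) => [|k IH]; first by rewrite expr0 rmorph1 mul1mx.
rewrite exprSr rmorphM /= -mulmxA linearZ /= -scalemxAl gv scalerA mulVf // scale1r.
exact: IH.
Qed.

Lemma idem_vec0 V (v : 'cV[K]_(mdim V)) (lam mu : K) : lam ^+ n = 1 -> lam != mu ->
  V g *m v = mu *: v -> V (idem lam) *m v = 0.
Proof.
move=> lamn lam_mu gv; apply/eqP; move: (idem lam) (idemg lamn) => e eg.
have := mulmxA (V e) (V g) v; rewrite gv -scalemxAr.
rewrite -[V _ *m V g]/(V _ * _) -rmorphM /= eg linearZ /= -scalemxAl => /eqP.
by rewrite -subr_eq0 -scalerBl scaler_eq0 subr_eq0 eq_sym (negPf lam_mu).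
Qed.

Lemma gidem lam : lam ^+ n = 1 -> g * idem lam = lam *: idem lam.
Proof.
move=> lamn; rewrite -idemg // /idem -scalerAl -scalerAr; congr (_ *: _).
apply: commr_sum => j _; apply: commrX.
by rewrite /GRing.comm -scalerAl -scalerAr.
Qed.

Lemma root1_omega (lam : K) : lam ^+ n = 1 -> exists i : 'Z_n, lam = omega ^+ i.
Proof.
move=> lamn; have [i ->] := prim_rootP prim_omega lamn.
have lt_i : (i < (Zp_trunc n).+2)%N by rewrite Zp_cast.
by exists (Ordinal lt_i).
Qed.

(** * Splitting off a maximal chain; generators of the Green ring *)

Lemma mul_col (a b c : nat) (A : 'M[K]_(a, b)) (B : 'M_(b, c)) j :
  A *m col j B = col j (A *m B).
Proof. by rewrite !colE mulmxA. Qed.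

(** The length [l.+1] is the nilpotency index of [h] on [V]; a chain of this maximal length splits
    off. *)
Lemma taft_split V : (0 < mdim V)%N ->
  exists l (i : 'Z_n) (le_l : (l.+1 <= d)%N) W,
    gclass V = gclass (M i le_l) + gclass W /\ mdim V = (l.+1 + mdim W)%N.
Proof.
move=> V_gt0; have [[_ hd _] _] := taft_gens taftH.
have nilh : exists l, V (h ^+ l) == 0 by exists d; rewrite hd raddf0.
case: (ex_minnP nilh) => -[|l] /eqP hl minl.
  have := congr1 (fun A : 'M_(mdim V) => A (Ordinal V_gt0) (Ordinal V_gt0)) hl.
  by rewrite expr0 rmorph1 !mxE eqxx => /eqP; rewrite oner_eq0.
have le_l : (l.+1 <= d)%N by apply: minl; rewrite hd raddf0.
have hge k : (l < k)%N -> V (h ^+ k) = 0.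
  by move=> lt_lk; rewrite -(subnK lt_lk) exprD rmorphM /= hl mulr0.
(* The projections sum to 1 and [h^l] acts nontrivially, so it is nonzero on the image of one of
   them. *)
have [i [b nz]] : exists (i : 'I_n) b, V (h ^+ l) *m col b (V (idem (omega ^+ i))) != 0.
  apply: contrapT => no; suff : (l.+1 <= l)%N by rewrite ltnn.
  apply/minl/eqP; rewrite -[h ^+ l]mulr1 -sum_idem mulr_sumr linear_sum big1 //= => i _.
  apply/matrixP=> a b; rewrite rmorphM /= [RHS]mxE.
  have : V (h ^+ l) *m col b (V (idem (omega ^+ i))) = 0.
    by apply/eqP/negPn/negP => nz; apply: no; exists i, b.
  by rewrite mul_col => /colP/(_ a); rewrite !mxE.
pose v := col b (V (idem (omega ^+ i))).
have gv : V g *m v = omega ^+ i *: v.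
  by rewrite mul_col -[V g *m _]/(V g * _) -rmorphM /= gidem ?omegaXn // linearZ /= linearZ.
have [a nz_a] : exists a, (V (h ^+ l) *m v) a 0 != 0.
  by apply/existsP; apply: contraNT nz => /existsPn z; apply/eqP/colP=> a;
     rewrite [RHS]mxE; apply/eqP/negPn/z.
pose c := (V (h ^+ l) *m v) a 0; pose mu := omega ^+ i * q ^- l.
have mun : mu ^+ n = 1 by rewrite exprMn omegaXn exprVn exprAC qXn expr1n invr1 mulr1.
(* A covector of the same weight [mu] as [h^l v], scaled to take the value 1 there. *)
pose phi := c^-1 *: row a (V (idem mu)).
have phig : phi *m V g = mu *: phi.
  rewrite -scalemxAl -row_mul -[_ *m V g]/(_ * V g) -rmorphM /= idemg //.
  by rewrite linearZ /= linearZ /= scalerA mulrC -scalerA.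
have phiv : (phi *m (V (h ^+ l) *m v)) 0 0 = 1.
  rewrite -scalemxAl -row_mul idem_vec; first by rewrite mxE [X in _ * X]mxE mulVf.
    exact: root1_neq0.
  exact: mulgh.
clearbody v phi.
have [i' mui'] : exists i' : 'Z_n, omega ^+ i = omega ^+ i'.
  by apply: root1_omega; rewrite omegaXn.
(* The dual chain: the [j]-th coordinate is [phi h^(l-j)], in reverse order so that [Q] intertwines
   the actions. *)
pose Q : 'M[K]_(l.+1, mdim V) := \matrix_(j, a) (phi *m V (h ^+ (l - j))) 0 a.
have Qmul k (X : 'M[K]_(mdim V, k)) (j : 'I_l.+1) e :
    (Q *m X) j e = (phi *m V (h ^+ (l - j)) *m X) 0 e.
  by rewrite !mxE; apply: eq_bigr => b' _; rewrite !mxE.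
pose P := chain v l.+1.
have homP : @hmod_hom _ _ (M i' le_l) V P by apply: chain_hom; rewrite -?mui' ?hl ?mul0mx.
have homQ : @hmod_hom _ _ V (M i' le_l) Q.
  apply: taft_hom; apply/matrixP=> j e; rewrite Qmul.
    rewrite taftM_actg mul_diag_mx -mulmxA -[V _ *m V g]/(V _ * V g) -rmorphM /= taft_hg.
    rewrite linearZ /= rmorphM /= -[V g * _]/(_ *m _) -scalemxAr mulmxA phig -scalemxAl.
    rewrite scalerA [LHS]mxE [RHS]mxE [Q _ _]mxE [X in _ = X * _]mxE; congr (_ * _).
    rewrite /mu mui' mulrCA; congr (_ * _).
    by rewrite expfB_cond ?(negPf q_neq0) ?leq_ord // mulrAC mulfV ?mul1r ?expf_neq0 ?q_neq0.
  rewrite -mulmxA -[V _ *m V h]/(V _ * V h) -rmorphM /= -exprSr taftM_acth [RHS]mxE.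
  case: j => -[|j] lt_j /=.
    by rewrite subn0 hl mulmx0 mxE big1 // => t _; rewrite !mxE mulr0n mul0r.
  rewrite (bigD1 (Ordinal (ltnW lt_j))) //= [X in _ + X]big1 => [|t].
    by rewrite addr0 !mxE /= eqxx mul1r -subSn // subSS.
  by rewrite [taftM_h _ _ _ _]mxE -val_eqE /= eqSS eq_sym => /negPf ->; rewrite mul0r.
have uQP : Q *m P \in unitmx.
  have QP j t : (Q *m P) j t = (phi *m (V (h ^+ (l - j + t)) *m v)) 0 0.
    by rewrite /P mul_chain Qmul exprD rmorphM /= -!mulmxA.
  (* The entry [phi h^(l-j+t) v] is 0 for [t > j] and 1 for [t = j], so the matrix is
     unitriangular. *)
  rewrite unitmxE det_trig; last first.
    apply/is_trig_mxP => j t lt_jt; rewrite QP hge ?mul0mx ?mulmx0 ?mxE //.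
    by rewrite -[X in (X < _)%N](subnK (leq_ord j)) ltn_add2l.
  by rewrite big1 ?unitr1 // => j _; rewrite QP subnK ?leq_ord.
have [W [eW dW]] := gclass_split homP homQ uQP.
by exists l, i', le_l, W.
Qed.

(** Induction on dimension with [taft_split]. An ordinal [l] in ['I_d] stands for the length
    [l.+1]. *)
Lemma taft_green_ind (P : green H -> Prop) :
    P 0 -> (forall a b, P a -> P b -> P (a - b)) ->
    (forall (l : 'I_d) (i : 'Z_n), P (gclass (M i (ltn_ord l)))) ->
  forall x, P x.
Proof.
move=> P0 PB PM; apply: green_ind => // V.
have PD a b : P a -> P b -> P (a + b).
  by move=> Pa Pb; rewrite -[b]opprK -[- b]sub0r; apply: (PB _ _ Pa); apply: (PB _ _ P0).
have [k le_k] := ubnP (mdim V); elim: k V le_k => // k IH V le_k.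
have [V0|V_gt0] := posnP (mdim V); first by rewrite gclass_dim0.
have [l [i [le_l [W [-> dV]]]]] := taft_split V_gt0.
apply: PD.
  have -> : le_l = ltn_ord (Ordinal le_l) by apply: bool_irrelevance.
  exact: (PM (Ordinal le_l) i).
by apply: IH; rewrite -ltnS (leq_trans _ le_k) // dV ltnS addSn ltnS leq_addl.
Qed.

(** * Rank invariants and independence of the classes *)

Definition rk (V : hmod H) k lam : int := (\rank (V (h ^+ k * idem lam)))%:Z.

(* On M(l, i) the difference rk k lam - rk k.+1 lam is 1 if l > k and lam is the
   weight of v_(l-k-1), the vector at height k above the socle, and 0 otherwise.
   Moving one step up the chain multiplies this weight by q, so the second
   difference vanishes unless that vector is the top v_0. *)
Definition mult (k : nat) (lam : K) (V : hmod H) : int :=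
  (rk V k lam - rk V k.+1 lam) - (rk V k.+1 (lam * q) - rk V k.+2 (lam * q)).

Lemma rank_hmod_iso V W x : hmod_iso V W -> \rank (V x) = \rank (W x).
Proof.
have le V' W' : hmod_iso V' W' -> (\rank (V' x) <= \rank (W' x))%N.
  case=> P [Q [PQ QP PV]].
  rewrite -[V' x]mul1mx -QP -mulmxA PV mulmxA.
  by rewrite (leq_trans (mxrankM_maxl _ _)) ?mxrankM_maxr.
move=> iso; apply/eqP; rewrite eqn_leq le //=; apply: le.
case: iso => P [Q [PQ QP PV]]; exists Q, P; split=> // y.
by rewrite -[LHS]mulmx1 -PQ mulmxA -(mulmxA Q) -PV !mulmxA QP mul1mx.
Qed.

Lemma mult_iso k lam V W : hmod_iso V W -> mult k lam V = mult k lam W.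
Proof. by move=> iso; rewrite /mult /rk !(rank_hmod_iso _ iso). Qed.

Lemma mult_sum k lam V W : mult k lam (hmod_sum V W) = mult k lam V + mult k lam W.
Proof.
have rkD j mu : rk (hmod_sum V W) j mu = rk V j mu + rk W j mu.
  by rewrite /rk [X in \rank X]/= rank_diag_block_mx PoszD.
by rewrite /mult !rkD !opprD !opprK !addrA; ring.
Qed.

Lemma weight_inj (c : K) s t : c != 0 -> (s < d)%N -> (t < d)%N ->
  c * q ^- s = c * q ^- t -> s = t.
Proof.
move=> c0 lt_s lt_t /(mulfI c0)/invr_inj/eqP.
by rewrite (eq_prim_root_expr prim_q) !modn_small // => /eqP.
Qed.

Lemma taftM_hXbvec l (i : 'Z_n) (le_l : (l <= d)%N) k j :
  M i le_l (h ^+ k) *m bvec K l j = bvec K l (j + k).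
Proof.
elim: k => [|k IH]; first by rewrite mact_expr0 addn0.
by rewrite mact_exprS IH taftM_acth taftM_h_bvec addnS.
Qed.

Lemma taftM_idem_bvec l (i : 'Z_n) (le_l : (l <= d)%N) lam j : lam ^+ n = 1 ->
  M i le_l (idem lam) *m bvec K l j
    = (omega ^+ i * q ^- j == lam)%:R *: bvec K l j.
Proof.
move=> lamn.
have gv : M i le_l g *m bvec K l j = (omega ^+ i * q ^- j) *: bvec K l j.
  by rewrite taftM_actg taftM_g_bvec.
have [E|ne] := eqVneq; last by rewrite scale0r (idem_vec0 lamn _ gv) // eq_sym.
by rewrite scale1r (idem_vec (root1_neq0 lamn)) // gv E.
Qed.

(** The weights along a chain are distinct by [weight_inj], so [h^k idem lam] is a matrix unit or 0;
    the sum, with at most one nonzero term, tests whether some [v_t] of weight [lam] survives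
    [h^k]. *)
Lemma taftM_rk l (i : 'Z_n) (le_l : (l <= d)%N) k lam : lam ^+ n = 1 ->
  rk (M i le_l) k lam = \sum_(t < l - k) (omega ^+ i * q ^- t == lam)%:Z.
Proof.
move=> lamn; pose A := M i le_l (h ^+ k * idem lam).
have AE (u v : 'I_l) : A u v = ((omega ^+ i * q ^- v == lam) && (u == v + k :> nat)%N)%:R.
  transitivity ((A *m bvec K l v) u 0).
    have -> : bvec K l v = delta_mx v 0 by apply/colP=> a; rewrite !mxE andbT.
    by rewrite -colE mxE.
  rewrite /A rmorphM /= -[_ * _]/(_ *m _) -mulmxA taftM_idem_bvec //.
  rewrite -scalemxAr taftM_hXbvec !mxE.
  by case: (_ == lam); rewrite ?mul1r ?mul0r.
have om0 : omega ^+ i != 0 by rewrite expf_neq0 ?omega_neq0.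
have lt_d t : (t < l - k)%N -> (t + k < l)%N by rewrite ltn_subRL addnC.
have [/existsP[t0 /eqP E0]|] := boolP [exists t : 'I_(l - k), omega ^+ i * q ^- t == lam].
  have lt_t0 := lt_d _ (ltn_ord t0).
  have lt_t0' := leq_ltn_trans (leq_addr k t0) lt_t0.
  have AD : A = delta_mx (Ordinal lt_t0) (Ordinal lt_t0').
    apply/matrixP=> u v; rewrite AE mxE; congr ((nat_of_bool _)%:R); rewrite -!val_eqE /=.
    have [vt|vt] := eqVneq (v : nat) t0; first by rewrite vt E0 eqxx andbT.
    rewrite andbF; apply/negbTE; rewrite negb_and; apply/orP; left; apply: contraNneq vt.
    rewrite -E0 => /(weight_inj om0) -> //; rewrite (leq_trans _ le_l) ?ltn_ord //.
  rewrite /rk -/A AD mxrank_delta (bigD1 t0) //= E0 eqxx big1 ?addr0 // => t.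
  rewrite -val_eqE /= => tt0; case: eqP => // E; case/eqP: tt0.
  apply: (weight_inj om0); last by rewrite E E0.
    by apply: leq_trans (leq_trans (leq_subr k l) le_l).
  exact: leq_trans lt_t0' le_l.
move=> /existsPn no; rewrite big1 => [|t _]; last by rewrite (negPf (no t)).
rewrite /rk -/A (_ : A = 0) ?mxrank0 //; apply/matrixP=> u v; rewrite AE mxE.
case: eqP => //= E; case: eqP => // uv.
have lt_v : (v < l - k)%N by rewrite ltn_subRL addnC -uv.
by have := no (Ordinal lt_v); rewrite /= E eqxx.
Qed.

Lemma taftM_mult l (i : 'Z_n) (le_l : (l <= d)%N) k (j : 'Z_n) :
  mult k (omega ^+ j) (M i le_l) = ((l == k.+1) && (i == j))%:Z.
Proof.
have jn := omegaXn j; have q0 := q_neq0.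
have jqn : (omega ^+ j * q) ^+ n = 1 by rewrite exprMn jn qXn mulr1.
have ij : (omega ^+ i == omega ^+ j) = (i == j).
  rewrite (eq_prim_root_expr prim_omega) -val_eqE /=.
  by rewrite !modn_small // -[X in (_ < X)%N](Zp_cast n_ge2).
rewrite /mult !taftM_rk //.
have [lt_lk|lt_kl|->] := ltngtP l k.+1.
- have le p : (k <= p)%N -> (l - p = 0)%N.
    by move=> kp; apply/eqP; rewrite subn_eq0 (leq_trans _ kp).
  by rewrite !le ?big_ord0 // -1?addn2 -1?addn1 leq_addr.
- rewrite -(subnK lt_kl); set p := (l - k.+2)%N.
  have -> : (p + k.+2 - k = p.+2)%N.
    by rewrite -addnBA ?(leq_trans (leqnSn k)) // ?subSn ?subnn ?addn2.
  have -> : (p + k.+2 - k.+1 = p.+1)%N by rewrite -addnBA // subSn // subnn addn1.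
  rewrite addnK !big_ord_recr /=.
  (* The last terms left by the two differences agree: [v_(p+1)] has weight [lam] exactly when [v_p]
     has weight [lam q]. *)
  have -> : (omega ^+ i / q ^+ p.+1 == omega ^+ j) = (omega ^+ i / q ^+ p == omega ^+ j * q).
    by rewrite -(inj_eq (mulIf q0)) exprSr invfM mulrA divfK.
  by ring.
rewrite subSnn subnn (_ : k.+1 - k.+2 = 0)%N ?big_ord0; last by apply/eqP; rewrite subn_eq0.
by rewrite big_ord1 !subr0 expr0 invr1 mulr1 ij.
Qed.

(** The functional induced by [mult k (omega ^+ j)] maps the relation to its single coefficient
    [a (k, j)]. *)
Lemma taftM_free (a : 'I_d * 'Z_n -> int) :
  \sum_t gclass (M t.2 (ltn_ord t.1)) *~ a t = 0 -> forall t, a t = 0.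
Proof.
move=> a0 [k j].
have [F [FB Fc]] := green_functional (@mult_iso k (omega ^+ j)) (@mult_sum k (omega ^+ j)).
pose fF := GRing.isZmodMorphism.Build _ _ F FB.
pose F' : {additive green H -> int} := HB.pack F fF.
have FM x z : F (x *~ z) = F x *~ z by apply: (raddfMz F').
have := congr1 F' a0; rewrite raddf0 raddf_sum (bigD1 (k, j)) //= big1 => [|[l i] ne] /=.
  by rewrite FM Fc taftM_mult !eqxx addr0 => <-; rewrite -mulrzl intz mulr1.
rewrite FM Fc taftM_mult eqSS [_ && _](_ : _ = false) ?mul0rz //.
by apply: contraNF ne; rewrite xpair_eqE -val_eqE.
Qed.

(** * Evaluation of polynomials in the Green ring *)

Lemma omegaN (i : 'Z_n) : omega ^+ (- i)%R = omega ^- i.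
Proof.
have oi : omega ^+ i != 0 by rewrite expf_neq0 ?omega_neq0.
by apply: (mulfI oi); rewrite -omegaD subrr mulfV.
Qed.

Lemma omega_nat k : omega ^+ (k%:R : 'Z_n) = omega ^+ k.
Proof. by rewrite val_Zp_nat // omega_mod. Qed.

Lemma omega_Nm : omega ^+ (- (m%:R : 'Z_n)) = q^-1.
Proof. by rewrite omegaN omega_nat omega_q. Qed.

Variables (le1 : (1 <= d)%N) (le2 : (2 <= d)%N).
Local Notation Y := (gclass (M (-1) le1)).
Local Notation Z := (gclass (M 0 le2)).

(** The Green ring is not given as commutative; evaluation at [Y] and then at [Z] is multiplicative
    because [Y] commutes with [Z]. *)
Lemma Ycomm l (i : 'Z_n) (le_l : (l <= d)%N) : GRing.comm Y (gclass (M i le_l)).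
Proof. by rewrite /GRing.comm gclass_taft1M gclass_taftM1 addrC. Qed.

Lemma YX k l (i : 'Z_n) (le_l : (l <= d)%N) :
  Y ^+ k * gclass (M i le_l) = gclass (M (i - k%:R) le_l).
Proof.
elim: k => [|k IH]; first by rewrite mul1r subr0.
by rewrite exprS -mulrA IH gclass_taft1M addrCA -opprD -mulrS.
Qed.

Lemma Yn : Y ^+ n = 1.
Proof.
rewrite -[LHS]mulr1 -(gclass_taft10 le1) YX.
by rewrite pchar_Zp // subr0.
Qed.

Fact comm_intY : commr_rmorph (intr : int -> green H) Y.
Proof. by move=> z; apply: commr_int. Qed.

Fact comm_YZ : commr_rmorph (horner_morph comm_intY) Z.
Proof.
move=> p; apply: commr_horner; first exact/commr_sym/Ycomm.
by move=> i; rewrite coef_map; apply/commr_sym/commr_int.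
Qed.

Definition taft_eval : {poly {poly int}} -> green H := horner_morph comm_YZ.
HB.instance Definition _ := GRing.RMorphism.on taft_eval.

Lemma taft_evaly : taft_eval polyy = Y.
Proof. by rewrite /taft_eval /polyy horner_morphC /= horner_morphX. Qed.

Lemma taft_evalz : taft_eval polyz = Z.
Proof. by rewrite /taft_eval /polyz horner_morphX. Qed.

Lemma subst_gfibSS k s : subst_ym k (gfib s.+2) =
  polyz * subst_ym k (gfib s.+1) - polyy ^+ k * subst_ym k (gfib s).
Proof.
rewrite /subst_ym [gfib _]/= rmorphB !rmorphM /= map_polyX map_polyC /=.
by rewrite comp_polyX -rmorphXn.
Qed.

(** The Fibonacci recursion is the product rule [gclass_taft2M_lt] solved for its longest summand;
    it starts from the zero module and the unit. *)
Lemma taft_eval_gfib s (le_s : (s <= d)%N) :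
  taft_eval (subst_ym m (gfib s)) = gclass (M 0 le_s).
Proof.
have [t] := ubnP s; elim: t => // t IH in s le_s *.
case: s le_s => [|[|s]] le_s; rewrite ltnS => lt_st.
- by rewrite /subst_ym !rmorph0 gclass_dim0.
- by rewrite /subst_ym !rmorph1 gclass_taft10.
have le_sS := ltnW le_s; have le_s0 := ltnW le_sS.
rewrite subst_gfibSS rmorphB !rmorphM rmorphXn /= taft_evaly taft_evalz.
rewrite (IH _ le_sS lt_st) (IH _ le_s0 (ltnW lt_st)) YX sub0r.
rewrite (@gclass_taft2M_lt _ le2 le_sS (- m%:R) le_s le_s0) ?addrK //.
exact: omega_Nm.
Qed.

(** The two generators vanish by [Y^n = 1] and by the product rule at the top length [d]. *)
Lemma taft_eval_ideal p : p \in taft_ideal n d -> taft_eval p = 0.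
Proof.
move=> /asboolP[a [b ->]]; rewrite rmorphD !rmorphM !rmorphB !rmorphXn rmorph1 /=.
rewrite taft_evaly taft_evalz Yn subrr mulr0 add0r (taft_eval_gfib (leqnn d)).
rewrite !mulrBl mul1r YX sub0r (gclass_taft2M_top le2 (leqnn d) omega_Nm).
by rewrite addrK subrr mulr0.
Qed.

(** * The map on the quotient ring and its spanning family *)

Local Notation Q := {ideal_quot (taft_ideal n d)}.

Definition taft_phi (x : Q) : green H := taft_eval (repr x).

Lemma taft_phi_pcls p : taft_phi (pcls n d p) = taft_eval p.
Proof.
apply/eqP; rewrite -subr_eq0 -rmorphB; apply/eqP/taft_eval_ideal.
by rewrite Quotient.idealrBE reprK.
Qed.

Fact taft_phi_zmod : zmod_morphism taft_phi.
Proof.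
elim/quotW => a; elim/quotW => b.
by rewrite -rmorphB !taft_phi_pcls rmorphB.
Qed.

Fact taft_phi_monoid : monoid_morphism taft_phi.
Proof.
split; first by rewrite -(rmorph1 \pi_Q) taft_phi_pcls rmorph1.
elim/quotW => a; elim/quotW => b.
by rewrite -rmorphM !taft_phi_pcls rmorphM.
Qed.

HB.instance Definition _ := GRing.isZmodMorphism.Build Q (green H) taft_phi taft_phi_zmod.
HB.instance Definition _ := GRing.isMonoidMorphism.Build Q (green H) taft_phi taft_phi_monoid.

Local Notation y := (\pi_Q polyy).
Local Notation z := (\pi_Q polyz).
Local Notation f s := (\pi_Q (subst_ym m (gfib s))).

Lemma taft_ideal_eq p p' : p - p' \in taft_ideal n d -> \pi_Q p = \pi_Q p'.
Proof. by rewrite Quotient.idealrBE => /eqP. Qed.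

Lemma quot_yn : y ^+ n = 1.
Proof.
rewrite -rmorphXn -(rmorph1 \pi_Q); apply: taft_ideal_eq; apply/asboolP.
by exists 1, 0; rewrite mul0r addr0 mul1r.
Qed.

Lemma quot_zf s : z * f s.+1 = f s.+2 + y ^+ m * f s.
Proof. by rewrite subst_gfibSS rmorphB !rmorphM rmorphXn /= subrK. Qed.

Lemma quot_zfd : z * f d = (y ^+ m + 1) * f d.
Proof.
rewrite -rmorphXn -(rmorph1 \pi_Q) -rmorphD -!rmorphM; apply: taft_ideal_eq.
apply/asboolP; exists 0, 1; rewrite mul0r add0r mul1r.
by rewrite -mulrBl opprD addrA.
Qed.

(** Preimage of [[M(l.+1, i)]] for [t = (l, i)]: [Y] has weight [omega^-1], hence the exponent
    [- i], read as its representative below [n]. *)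
Definition qbasis (t : 'I_d * 'Z_n) : Q := y ^+ (- t.2)%R * f t.1.+1.

Lemma taft_phi_qbasis t : taft_phi (qbasis t) = gclass (M t.2 (ltn_ord t.1)).
Proof.
case: t => l i; rewrite /qbasis [(l, i).1]/= [(l, i).2]/=.
move: (- i) (opprK i) => j <-.
rewrite -rmorphXn -rmorphM /= -[\pi_Q _]/(pcls n d _) taft_phi_pcls rmorphM rmorphXn /=.
by rewrite taft_evaly (taft_eval_gfib (ltn_ord l)) YX sub0r natr_Zp.
Qed.

Definition qspan (x : Q) : Prop :=
  exists a : 'I_d * 'Z_n -> int, x = \sum_t qbasis t *~ a t.

Lemma qspanB x x' : qspan x -> qspan x' -> qspan (x - x').
Proof.
move=> [a ->] [a' ->]; exists (fun t => a t - a' t).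
by rewrite -sumrB; apply: eq_bigr => t _; rewrite mulrzBr.
Qed.

Lemma qspan0 : qspan 0.
Proof. by exists (fun=> 0); rewrite big1 // => t _; rewrite mulr0z. Qed.

Lemma qspanD x x' : qspan x -> qspan x' -> qspan (x + x').
Proof.
move=> Sx Sx'; rewrite -[x']opprK -[- x']sub0r.
exact/(qspanB Sx)/(qspanB qspan0).
Qed.

Lemma qspanMz x k : qspan x -> qspan (x *~ k).
Proof.
move=> [a ->]; exists (fun t => a t * k).
by rewrite mulrz_suml; apply: eq_bigr => t _; rewrite mulrzA.
Qed.

Lemma qspan_qbasis t : qspan (qbasis t).
Proof.
exists (fun t' => (t' == t)%:Z); rewrite (bigD1 t) //= eqxx mulr1z big1 ?addr0 //.
by move=> t' /negPf->; rewrite mulr0z.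
Qed.

Lemma qspan_yf k s : (s <= d)%N -> qspan (y ^+ k * f s).
Proof.
case: s => [|s] le_s; first by rewrite /subst_ym /= !rmorph0 mulr0; apply: qspan0.
suff <- : qbasis (Ordinal le_s, - k%:R) = y ^+ k * f s.+1 by apply: qspan_qbasis.
rewrite /qbasis [(_, _).2]/= opprK val_Zp_nat //; congr (_ * _).
by rewrite expr_mod // quot_yn.
Qed.

Lemma qspanM w x : (forall t, qspan (w * qbasis t)) -> qspan x -> qspan (w * x).
Proof.
move=> wB [a ->]; rewrite mulr_sumr; apply: (big_ind qspan).
- exact: qspan0.
- exact: qspanD.
by move=> t _; rewrite mulrzAr; apply: qspanMz.
Qed.

Lemma qspany x : qspan x -> qspan (y * x).
Proof.
by apply: qspanM => t; rewrite /qbasis mulrA -exprS; apply/qspan_yf/ltn_ord.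
Qed.

(** Below the top the recursion keeps the product in the family; at [l.+1 = d] the second generator
    of the ideal replaces [z] by [y^m + 1]. *)
Lemma qspanz x : qspan x -> qspan (z * x).
Proof.
apply: qspanM => -[l i]; have lt_l := ltn_ord l.
rewrite /qbasis [(_, _).1]/= [(_, _).2]/= mulrCA.
have [lt_lS|ge_lS] := ltnP l.+1 d.
  rewrite quot_zf mulrDr mulrA -exprD; apply: qspanD; apply: qspan_yf => //.
  exact: ltnW.
have -> : l.+1 = d by apply/eqP; rewrite eqn_leq lt_l.
rewrite quot_zfd mulrDl mul1r mulrDr mulrA -exprD.
by apply: qspanD; apply: qspan_yf.
Qed.

(** The span contains [1 = f 1] and is stable under [y] and [z], so Horner induction, first in [z]
    and then in [y], reaches every polynomial. *)
Lemma qspan_all x : qspan x.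
Proof.
elim/quotW: x; elim/poly_ind => [|p c IHp]; first by rewrite rmorph0; apply: qspan0.
rewrite rmorphD rmorphM mulrC; apply: qspanD; first exact: qspanz.
elim/poly_ind: c => [|c k IHc]; first by rewrite !rmorph0; apply: qspan0.
rewrite polyCD polyCM rmorphD rmorphM mulrC; apply: qspanD; first exact: qspany.
rewrite -[k]intz !rmorph_int; apply: qspanMz.
by have := @qspan_yf 0 1 le1; rewrite expr0 mul1r /subst_ym /= !rmorph1.
Qed.

(** The spanning family goes to independent classes, so a combination in the kernel has all
    coefficients 0. *)
Lemma taft_phi_inj : injective taft_phi.
Proof.
apply: raddf_inj => x; have [a ->] := qspan_all x; rewrite raddf_sum /= => ax0.
rewrite big1 // => t _; rewrite (@taftM_free a) ?mulr0z // -[RHS]ax0.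
by apply: eq_bigr => t' _; rewrite raddfMz /= taft_phi_qbasis.
Qed.

Lemma taft_phi_surj u : exists x, taft_phi x = u.
Proof.
elim/taft_green_ind: u => [|_ _ [x <-] [x' <-]|l i].
- by exists 0; rewrite raddf0.
- by exists (x - x'); rewrite raddfB.
by exists (qbasis (l, i)); rewrite taft_phi_qbasis.
Qed.

Lemma taft_phi_bij : bijective taft_phi.
Proof.
pose psi u := sval (cid (taft_phi_surj u)).
have psiK u : taft_phi (psi u) = u by rewrite /psi; case: cid.
by exists psi => // x; apply: taft_phi_inj; rewrite psiK.
Qed.

End Taft.

Unset Implicit Arguments.

Theorem theorem3p4 (K : closedFieldType) (charK0 : [pchar K] =i pred0)
    (n d : nat) (n_ge2 : (2 <= n)%N) (d_ge2 : (2 <= d)%N) (d_dvd_n : (d %| n)%N)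
    (q : K) (prim_q : d.-primitive_root q)
    (omega : K) (prim_omega : n.-primitive_root omega)
    (omega_q : omega ^+ (n %/ d) = q)
    (H : hopfAlg K) (g h : H) (taftH : is_gen_taft n d q g h) :
  let M := taftM taftH prim_omega omega_q in
  let m := (n %/ d)%N in
  exists phi : {rmorphism {ideal_quot (taft_ideal n d)} -> green H},
    [/\ bijective phi,
        phi (pcls n d polyy) = gclass (M 1%N (-1) (ltnW d_ge2)),
        phi (pcls n d polyz) = gclass (M 2%N 0 d_ge2)
      & forall (s : nat) (s_le_d : (s <= d)%N), (2 <= s)%N ->
          phi (pcls n d (subst_ym m (gfib s))) = gclass (M s 0 s_le_d)].
Proof.
move=> M m.
exists (taft_phi n_ge2 d_ge2 prim_q prim_omega omega_q taftH (ltnW d_ge2) d_ge2).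
split.
- exact: taft_phi_bij.
- by rewrite [LHS]taft_phi_pcls taft_evaly.
- by rewrite [LHS]taft_phi_pcls taft_evalz.
move=> s s_le_d _.
by rewrite [LHS]taft_phi_pcls taft_eval_gfib.
Qed.
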